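(* Let $(\mathcal{C},\mathcal{D})$ be a $C^*$-inclusion with $\mathcal{D}$ abelian. Then the following statements hold. (i) $\operatorname{Ext}(\operatorname{PsExp}(\mathcal{C},\mathcal{D})) \neq \emptyset$. (ii) For $x \in \mathcal{C}_{sa}$, define $P(x) = \sup_{I(\mathcal{D})}\{\Psi(x) : \Psi \in \operatorname{Ext}(\operatorname{PsExp}(\mathcal{C},\mathcal{D}))\}$. Then $$\operatorname{PsExp}(\mathcal{C},\mathcal{D}) = \{\Phi \in \operatorname{UCP}(\mathcal{C},I(\mathcal{D})) : \Phi(x) \leq P(x) \text{ for all } x \in \mathcal{C}_{sa}\}.$$ In particular, there exists a unique $\Phi \in \operatorname{PsExp}(\mathcal{C},\mathcal{D})$ if and only if there exists a unique $\Psi \in \operatorname{Ext}(\operatorname{PsExp}(\mathcal{C},\mathcal{D}))$.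
   Context: All $C^*$-algebras are unital. A $C^*$-inclusion $(\mathcal{C},\mathcal{D})$ is a pair of unital $C^*$-algebras with $\mathcal{D} \subseteq \mathcal{C}$ and having the same unit. ''ucp'' means unital completely positive. A $C^*$-algebra is injective if it is an injective object in the category of operator systems and ucp maps. $I(\mathcal{D})$ denotes a fixed injective envelope of $\mathcal{D}$: an injective unital $C^*$-algebra containing $\mathcal{D}$ as a unital $C^*$-subalgebra, such that for every injective operator system $\mathcal{S}$ and unital complete isometry $\tau:\mathcal{D}\to\mathcal{S}$ there is a unital complete isometry $\tau_1:I(\mathcal{D})\to\mathcal{S}$ with $\tau_1|_{\mathcal{D}}=\tau$ (it always exists). $\operatorname{UCP}(\mathcal{C},I(\mathcal{D}))$ is the set of ucp maps $\mathcal{C}\to I(\mathcal{D})$. A pseudo-expectation for $(\mathcal{C},\mathcal{D})$ is a ucp map $\Phi:\mathcal{C}\to I(\mathcal{D})$ with $\Phi|_{\mathcal{D}}=\operatorname{id}$; $\operatorname{PsExp}(\mathcal{C},\mathcal{D})$ is the (nonempty, convex) set of all pseudo-expectations. $\operatorname{Ext}(K)$ is the set of extreme points of a convex set $K$. $\mathcal{C}_{sa}$ is the set of self-adjoint elements. When $\mathcal{D}$ is abelian, $I(\mathcal{D})$ is abelian and order complete, i.e. every nonempty subset of $I(\mathcal{D})_{sa}$ with an upper bound has a supremum in $I(\mathcal{D})_{sa}$; $\sup_{I(\mathcal{D})}$ denotes this supremum. *)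

(* Defs.v *)
From HB Require Import structures.
From mathcomp Require Import all_boot all_order all_algebra complex.
From mathcomp Require Import all_classical all_reals.

Set Implicit Arguments.
Unset Strict Implicit.
Unset Printing Implicit Defensive.

Import Order.TTheory GRing.Theory Num.Theory.
Local Open Scope classical_set_scope.
Local Open Scope ring_scope.
Local Open Scope complex_scope.

(* The norm is a field of the structure rather than the MathComp-Analysis norm:
   Hierarchy-Builder rejects a join of rings and normed modules, because
   numDomainType already inherits from both.  The norm takes values in [R]
   itself, not in [R[i]]. *)
HB.mixin Record Algebra_isCStar (R : realType) A of GRing.Algebra R[i] A := {
  star : A -> A;
  cnorm : A -> R;
  starK : involutive star;
  starD : {morph star : x y / x + y};
  starZ : forall (a : R[i]) x, star (a *: x) = conjc a *: star x;
  starM : forall x y, star (x * y) = star y * star x;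
  cnorm0_eq0 : forall x, cnorm x = 0 -> x = 0;
  cnormD_le : forall x y, cnorm (x + y) <= cnorm x + cnorm y;
  cnormZ : forall (a : R[i]) x, cnorm (a *: x) = Normc.normc a * cnorm x;
  cnormM_le : forall x y, cnorm (x * y) <= cnorm x * cnorm y;
  cnorm_star_mul : forall x, cnorm (star x * x) = cnorm x ^+ 2;
  cnorm_complete : forall u : nat -> A,
    (forall e : R, 0 < e -> exists N, forall m n,
       (N <= m)%N -> (N <= n)%N -> cnorm (u m - u n) < e) ->
    exists l, forall e : R, 0 < e -> exists N, forall n,
      (N <= n)%N -> cnorm (u n - l) < e
}.

#[short(type="cstarAlgType")]
HB.structure Definition CStarAlgebra (R : realType) :=
  {A of GRing.Algebra R[i] A & Algebra_isCStar R A}.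

Section Order.
Variables (R : realType) (A : cstarAlgType R).

Definition selfadjoint : set A := [set x | star x = x].

Definition positive (x : A) := exists y : A, x = star y * y.

Definition cle (x y : A) := positive (y - x).

Definition is_sup_sa (S : set A) (s : A) :=
  [/\ selfadjoint s, forall x, S x -> cle x s &
      forall u, selfadjoint u -> (forall x, S x -> cle x u) -> cle s u].

End Order.

Section Matrices.
Variables (R : realType) (A : cstarAlgType R).

Definition mxstar m n (X : 'M[A]_(m, n)) : 'M[A]_(n, m) :=
  (map_mx (@star R A) X)^T.

Definition mxpositive n (X : 'M[A]_n) := exists Y : 'M[A]_n, X = mxstar Y *m Y.

(* The C*-norm of M_n(A) is the operator norm for its action on the right
   Hilbert A-module A^n, whose A-valued inner product is
   <v, w> = \sum_i (v_i)^* w_i. *)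
Definition cvnorm n (v : 'cV[A]_n) : R :=
  Num.sqrt (cnorm (\sum_i star (v i 0) * v i 0)).

Definition mxnorm n (X : 'M[A]_n) : R :=
  sup [set cvnorm (X *m v) | v in [set v | cvnorm v <= 1]].

End Matrices.

(* Operator systems are represented concretely, as unital self-adjoint subspaces
   of C*-algebras, with the matrix order and matrix norms of the ambient
   algebra.  A map between operator systems S of A and T of B is represented by
   a function A -> B, of which only the values on S matter. *)
Section OperatorSystems.
Variable R : realType.

Definition operator_system (A : cstarAlgType R) (S : set A) :=
  [/\ S 1, forall (a : R[i]) x y, S x -> S y -> S (a *: x + y) &
      forall x, S x -> S (star x)].

Definition unital_linear_on (A B : cstarAlgType R) (S : set A) (T : set B)
    (f : A -> B) :=
  [/\ f 1 = 1, forall x, S x -> T (f x) &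
      forall (a : R[i]) x y, S x -> S y -> f (a *: x + y) = a *: f x + f y].

Definition ucp (A B : cstarAlgType R) (S : set A) (T : set B) (f : A -> B) :=
  unital_linear_on S T f /\
  forall n (X : 'M[A]_n), (forall i j, S (X i j)) ->
    mxpositive X -> mxpositive (map_mx f X).

Definition unital_complete_isometry (A B : cstarAlgType R) (S : set A)
    (T : set B) (f : A -> B) :=
  unital_linear_on S T f /\
  forall n (X : 'M[A]_n), (forall i j, S (X i j)) ->
    mxnorm (map_mx f X) = mxnorm X.

Definition injective_system (A : cstarAlgType R) (S : set A) :=
  forall (B : cstarAlgType R) (E F : set B),
    operator_system E -> operator_system F -> E `<=` F ->
    forall f : B -> A, ucp E S f ->
    exists2 g : B -> A, ucp F S g & forall x, E x -> g x = f x.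

End OperatorSystems.

(* Injective *-homomorphisms between C*-algebras are isometric with closed
   range, so these are exactly the inclusions of unital C*-subalgebras. *)
Definition star_embedding (R : realType) (A B : cstarAlgType R)
    (f : {lrmorphism A -> B}) :=
  (forall x, f (star x) = star (f x)) /\ injective f.

Definition injective_envelope (R : realType) (D E : cstarAlgType R)
    (iota : {lrmorphism D -> E}) :=
  [/\ star_embedding iota, injective_system [set: E] &
      forall (A : cstarAlgType R) (S : set A),
        operator_system S -> injective_system S ->
        forall tau : D -> A, unital_complete_isometry [set: D] S tau ->
        exists2 tau1 : E -> A, unital_complete_isometry [set: E] S tau1 &
          forall d, tau1 (iota d) = tau d].

Definition UCP (R : realType) (C E : cstarAlgType R) : set (C -> E) :=
  [set Phi | ucp [set: C] [set: E] Phi].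

Definition PsExp (R : realType) (C D E : cstarAlgType R)
    (j : {lrmorphism D -> C}) (iota : {lrmorphism D -> E}) : set (C -> E) :=
  [set Phi | UCP Phi /\ forall d, Phi (j d) = iota d].

Definition Ext (R : realType) (V : lmodType R[i]) (K : set V) : set V :=
  [set x | K x /\ forall y z (t : R), K y -> K z -> 0 < t < 1 ->
     x = t%:C *: y + (1 - t)%:C *: z -> y = x /\ z = x].

(* Main.v *)
Require Import Defs.
From HB Require Import structures.
From mathcomp Require Import all_boot all_order all_algebra complex.
From mathcomp Require Import all_classical all_reals.
From mathcomp Require Import ring lra.
Import Order.TTheory GRing.Theory Num.Theory.
Local Open Scope classical_set_scope.
Local Open Scope ring_scope.
Local Open Scope complex_scope.
Set Implicit Arguments.
Unset Strict Implicit.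
Unset Printing Implicit Defensive.

(** Let [E] be the injective envelope of the commutative algebra [D], and for a
    self-adjoint [x] in [C] let [p x] be the infimum in [E] of the [iota d] over
    the self-adjoint [d] with [x <= j d].  A positive linear map [C -> E]
    extending [iota] lies below [p] on self-adjoint elements, and conversely a
    linear map below [p] there is positive and extends [iota].  So if positive maps into [E] are automatically
    completely positive, the pseudo-expectations are the linear maps dominated
    by the sublinear map [p].  Such a set has enough extreme points: for each
    [x] there is an extreme one with value [p x] at [x].  Hence [p] is the
    supremum [P] of the statement, and everything follows; for instance if
    there is one extreme point [Psi] then [p = Psi] on self-adjoint elements,
    and a linear map below a linear map equals it.

    The extreme points come from [sublinear_extreme], a Hahn-Banach-Kantorovich
    and Krein-Milman theorem for maps into an order-complete ordered space.
    Faces are encoded by smaller sublinear maps; imposing the largest possible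
    value at [x] gives a face, infima of chains of faces are faces, and a face
    that is minimal for these operations is a single linear map.
    [positive_extension] is its form for operator systems.  It is used three
    times: for pseudo-expectations, for the states of [D], whose extreme points
    are characters, and for the injectivity of algebras of bounded functions.

    That [E] is order complete and that positive maps into it are completely
    positive are both inherited from the algebra [L] of bounded functions on the
    characters of [D].  The Gelfand map [D -> L] is a unital complete isometry
    into an injective algebra, so it extends to a unital complete isometry
    [tau : E -> L]; a unital complete isometry and its inverse are completely
    positive, so injectivity of [E] extends the inverse of [tau] to a ucp map
    [rho : L -> E] with [rho o tau = id].  Infima in [E] are images under [rho]
    of pointwise infima, and a positive map [Phi] into [E] is [rho] composed
    with the positive map [tau o Phi] into bounded functions.

    All this rests on the order structure of C*-algebras and of the matrix
    algebras over them.  The cone [pcone], defined by a norm condition, is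
    convex; square roots of its elements come from an iteration, and [pcone_gram]
    shows that it contains every [y* y].  Matrices over a C*-algebra form a
    C*-algebra for the operator norm on columns, by the Cauchy-Schwarz
    inequality for algebra-valued inner products, and [mxpositive_ip] recognizes
    its positive elements by their quadratic forms. *)

(** * Norm and involution *)

Section Norm.
Context {R : realType} {A : cstarAlgType R}.
Implicit Types (x y z : A) (t : R).

Lemma normcR t : Normc.normc t%:C = `|t|.
Proof. by rewrite /= expr0n addr0 sqrtr_sqr. Qed.

Lemma cnorm0 : cnorm (0 : A) = 0.
Proof. by rewrite -(scale0r (0 : A)) cnormZ Normc.normc0 mul0r. Qed.

Lemma cnormN x : cnorm (- x) = cnorm x.
Proof.
rewrite -scaleN1r cnormZ -[-1](rmorphN1 (real_complex R)).
by rewrite normcR normrN1 mul1r.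
Qed.

Lemma cnorm_ge0 x : 0 <= cnorm x.
Proof. by have := cnormD_le x (- x); rewrite subrr cnorm0 cnormN; lra. Qed.

Lemma cnorm_eq0 x : (cnorm x == 0) = (x == 0).
Proof.
by apply/eqP/eqP => [/cnorm0_eq0|->]; rewrite ?cnorm0.
Qed.

Lemma cnorm_gt0 x : (0 < cnorm x) = (x != 0).
Proof. by rewrite lt_def cnorm_ge0 andbT cnorm_eq0. Qed.

Lemma cnormZR t x : 0 <= t -> cnorm (t%:C *: x) = t * cnorm x.
Proof. by move=> t0; rewrite cnormZ normcR ger0_norm. Qed.

Lemma cnormB x y : cnorm (x - y) = cnorm (y - x).
Proof. by rewrite -cnormN opprB. Qed.

Lemma cnormB_le x y : cnorm (x - y) <= cnorm x + cnorm y.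
Proof. by rewrite -(cnormN y) cnormD_le. Qed.

Lemma cnorm_distD z x y : cnorm (x - y) <= cnorm (x - z) + cnorm (z - y).
Proof. by rewrite -(subrKA z x) cnormD_le. Qed.

Lemma cnorm_sum (I : Type) (r : seq I) (F : I -> A) :
  cnorm (\sum_(i <- r) F i) <= \sum_(i <- r) cnorm (F i).
Proof.
elim: r => [|i r IH]; first by rewrite !big_nil cnorm0.
by rewrite !big_cons (le_trans (cnormD_le _ _)) // lerD2l.
Qed.

Lemma star0 : star (0 : A) = 0.
Proof.
by have := starD (0 : A) 0; rewrite addr0 => /esym/(canRL (addrK _)); rewrite subrr.
Qed.

Lemma starN x : star (- x) = - star x.
Proof. by apply/eqP; rewrite -addr_eq0 -starD addNr star0. Qed.

Lemma starB x y : star (x - y) = star x - star y.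
Proof. by rewrite starD starN. Qed.

Lemma star1 : star (1 : A) = 1.
Proof. by rewrite -[LHS]mul1r -{1}(starK 1) -starM mul1r starK. Qed.

Lemma star_sum (I : Type) (r : seq I) (F : I -> A) :
  star (\sum_(i <- r) F i) = \sum_(i <- r) star (F i).
Proof. exact: (big_morph _ starD star0). Qed.

Lemma starZR t x : star (t%:C *: x) = t%:C *: star x.
Proof. by rewrite starZ conjc_real. Qed.

Lemma cnorm_star x : cnorm (star x) = cnorm x.
Proof.
suff H y : cnorm y <= cnorm (star y).
  by apply: le_anti; rewrite H -{2}(starK x) H.
have [->|y0] := eqVneq y 0; first by rewrite star0.
have := cnormM_le (star y) y; rewrite cnorm_star_mul expr2 ler_pM2r //.
by rewrite cnorm_gt0.
Qed.

Lemma cnorm1 : cnorm (1 : A) = 1.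
Proof.
have := cnorm_star_mul (1 : A); rewrite star1 mul1r expr2.
rewrite -{1}[cnorm 1]mulr1 => /mulfI -> //.
by rewrite cnorm_eq0 oner_eq0.
Qed.

Lemma cnormR t : 0 <= t -> cnorm (t%:C%:A : A) = t.
Proof. by move=> t0; rewrite cnormZR // cnorm1 mulr1. Qed.

Lemma sa_normsq x : selfadjoint x -> cnorm (x * x) = cnorm x ^+ 2.
Proof. by move=> xs; rewrite -{1}xs cnorm_star_mul. Qed.

Lemma sa0 : selfadjoint (0 : A). Proof. exact: star0. Qed.
Lemma sa1 : selfadjoint (1 : A). Proof. exact: star1. Qed.
Lemma saD x y : selfadjoint x -> selfadjoint y -> selfadjoint (x + y).
Proof. by rewrite /selfadjoint /= starD => -> ->. Qed.
Lemma saN x : selfadjoint x -> selfadjoint (- x).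
Proof. by rewrite /selfadjoint /= starN => ->. Qed.
Lemma saB x y : selfadjoint x -> selfadjoint y -> selfadjoint (x - y).
Proof. by move=> xs ys; apply: saD => //; apply: saN. Qed.
Lemma saZ t x : selfadjoint x -> selfadjoint (t%:C *: x).
Proof. by rewrite /selfadjoint /= starZR => ->. Qed.
Lemma saR t : selfadjoint (t%:C%:A : A). Proof. exact/saZ/sa1. Qed.
Lemma sa_sq x : selfadjoint x -> selfadjoint (x * x).
Proof. by rewrite /selfadjoint /= starM => ->. Qed.
Lemma saM x y : selfadjoint x -> selfadjoint y -> x * y = y * x ->
  selfadjoint (x * y).
Proof. by rewrite /selfadjoint /= starM => -> -> ->. Qed.

Definition cconv (u : nat -> A) (l : A) := forall e : R, 0 < e ->
  exists N, forall n, (N <= n)%N -> cnorm (u n - l) < e.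

Lemma cconv_unique u l l' : cconv u l -> cconv u l' -> l = l'.
Proof.
move=> ul ul'; apply/eqP; rewrite -subr_eq0 -cnorm_eq0 eq_le cnorm_ge0 andbT.
apply/ler_addgt0Pr => e e0; rewrite add0r.
have e20 : 0 < e / 2 by lra.
have [N1 h1] := ul _ e20; have [N2 h2] := ul' _ e20.
have := h1 _ (leq_maxl N1 N2); have := h2 _ (leq_maxr N1 N2).
have := cnorm_distD (u (maxn N1 N2)) l l'; rewrite (cnormB l (u _)); lra.
Qed.

Lemma cconv_le (u v : nat -> A) l m (k : R) : 
  (forall n, cnorm (v n - m) <= k * cnorm (u n - l)) -> cconv u l -> cconv v m.
Proof.
move=> H ul e e0.
have k1 : 0 < `|k| + 1 by rewrite ltr_pwDr.
have [N hN] := ul (e / (`|k| + 1)) (divr_gt0 e0 k1).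
exists N => n /hN; rewrite ltr_pdivlMr // mulrC; apply: le_lt_trans.
apply: (le_trans (H n)); apply: ler_wpM2r; first exact: cnorm_ge0.
by rewrite (le_trans (ler_norm k)) // lerDl.
Qed.

Lemma cconvS u l : cconv u l -> cconv (fun n => u n.+1) l.
Proof. by move=> ul e /ul[N hN]; exists N => n Nn; apply/hN/leqW. Qed.

Lemma cconv_star u l : cconv u l -> cconv (fun n => star (u n)) (star l).
Proof.
by apply: (@cconv_le _ _ _ _ 1) => n; rewrite mul1r -starB cnorm_star.
Qed.

Lemma cconvMl x u l : cconv u l -> cconv (fun n => x * u n) (x * l).
Proof. by apply: (@cconv_le _ _ _ _ (cnorm x)) => n; rewrite -mulrBr cnormM_le. Qed.

Lemma cconvMr x u l : cconv u l -> cconv (fun n => u n * x) (l * x).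
Proof.
by apply: (@cconv_le _ _ _ _ (cnorm x)) => n; rewrite -mulrBl mulrC cnormM_le.
Qed.

Lemma cconv_norm_le u l t : (forall n, cnorm (u n) <= t) -> cconv u l ->
  cnorm l <= t.
Proof.
move=> ut ul; apply/ler_addgt0Pr => e /ul[N /(_ N (leqnn N))].
have := cnorm_distD (u N) l 0; rewrite !subr0 (cnormB (u N)).
by have := ut N; lra.
Qed.

Lemma subsq_mul x y : x * x - y * y = x * (x - y) + (x - y) * y.
Proof. by rewrite mulrBr mulrBl subrKA. Qed.

End Norm.

(** * Square roots *)

Section SquareRoot.
Context {R : realType}.

(** The case of the number [1] of the iteration in [cstar_sqrt1]; it dominates
    all the others. *)
Fixpoint sqrt_major (n : nat) : R :=
  if n is m.+1 then 2^-1 * (1 + sqrt_major m ^+ 2) else 0.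

Lemma sqrt_majorS n : sqrt_major n.+1 = 2^-1 * (1 + sqrt_major n ^+ 2).
Proof. by []. Qed.

Lemma sqrt_major_bounds n :
  [/\ 0 <= sqrt_major n, sqrt_major n <= 1 & sqrt_major n <= sqrt_major n.+1].
Proof.
elim: n => [|n [a b c]]; first by rewrite sqrt_majorS /= expr0n /=; split; lra.
split.
- by have := sqr_ge0 (sqrt_major n); rewrite sqrt_majorS; lra.
- by have : sqrt_major n ^+ 2 <= 1; [rewrite expr2; nra | rewrite sqrt_majorS; lra].
have : sqrt_major n ^+ 2 <= sqrt_major n.+1 ^+ 2.
  by rewrite ler_sqr // nnegrE (le_trans a).
by rewrite (sqrt_majorS n.+1) => h; rewrite {1}sqrt_majorS; lra.
Qed.

Lemma sqrt_major_cauchy (e : R) : 0 < e -> exists N, forall n, (N <= n)%N ->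
  sqrt_major n - sqrt_major N < e.
Proof.
move=> e0.
have hs : has_sup (range sqrt_major).
  split; first by exists (sqrt_major 0), 0%N.
  by exists 1 => _ [n _ <-]; case: (sqrt_major_bounds n).
have [_ [N _ <-] hN] := sup_adherent e0 hs.
exists N => n _; have : sqrt_major n <= sup (range sqrt_major).
  by apply: ub_le_sup; [case: hs | exists n].
lra.
Qed.

Context {A : cstarAlgType R}.
Implicit Types (x y z : A) (t : R).

(** The fixed points of [z = (x + z ^ 2) / 2] satisfy [(1 - z) ^ 2 = 1 - x].
    Each step of the iteration from [0] has norm at most the corresponding step
    of [sqrt_major], a bounded increasing sequence, so the iteration converges;
    its terms are polynomials in [x], whence the commutation. *)
Lemma cstar_sqrt1 x : selfadjoint x -> cnorm x <= 1 ->
  exists z, [/\ selfadjoint z, cnorm z <= 1, (1 - z) * (1 - z) = 1 - x &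
    forall y, x * y = y * x -> z * y = y * z].
Proof.
move=> xs x1.
pose fix u (n : nat) : A :=
  if n is m.+1 then (2^-1)%:C *: (x + u m * u m) else 0.
have uS n : u n.+1 = (2^-1)%:C *: (x + u n * u n) by [].
have h20 : 0 <= 2^-1 :> R by lra.
have un n : cnorm (u n) <= sqrt_major n.
  elim: n => [|n IH] /=; first by rewrite cnorm0.
  rewrite cnormZR // ler_wpM2l //.
  apply: (le_trans (cnormD_le _ _)); apply: lerD => //.
  rewrite expr2; apply: (le_trans (cnormM_le _ _)).
  by apply: ler_pM => //; exact: cnorm_ge0.
have du n : cnorm (u n.+1 - u n) <= sqrt_major n.+1 - sqrt_major n.
  elim: n => [|n IH].
    by rewrite subr0 [sqrt_major 0]/= subr0; exact: (un 1%N).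
  rewrite (uS n.+1) {3}(uS n) -scalerBr opprD addrACA subrr add0r.
  rewrite cnormZR // subsq_mul.
  have -> : sqrt_major n.+2 - sqrt_major n.+1 = 2^-1 *
     (sqrt_major n.+1 * (sqrt_major n.+1 - sqrt_major n) +
     (sqrt_major n.+1 - sqrt_major n) * sqrt_major n).
    rewrite (sqrt_majorS n.+1) mulrBl [RHS]mulrDr mulrBr.
    have := sqrt_majorS n; lra.
  rewrite ler_wpM2l // (le_trans (cnormD_le _ _)) // lerD //;
    apply: (le_trans (cnormM_le _ _));
    by apply: ler_pM => //; try exact: cnorm_ge0; apply: un.
have duk m k : cnorm (u (k + m)%N - u m) <= sqrt_major (k + m) - sqrt_major m.
  elim: k => [|k IH]; first by rewrite add0n !subrr cnorm0.
  rewrite addSn; have := cnorm_distD (u (k + m)%N) (u (k + m).+1) (u m).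
  by have := du (k + m)%N; lra.
have [z uz] : exists z, cconv u z.
  apply: cnorm_complete => e e0.
  have e20 : 0 < e / 2 by lra.
  have [N hN] := sqrt_major_cauchy e20.
  exists N => m n Nm Nn.
  have := duk N (m - N)%N; have := duk N (n - N)%N; rewrite !subnK //.
  have := hN _ Nm; have := hN _ Nn.
  have := cnorm_distD (u N) (u m) (u n); rewrite (cnormB (u N) (u n)); lra.
have uz1 : cnorm z <= 1.
  apply: cconv_norm_le uz => n; apply: (le_trans (un n)).
  by case: (sqrt_major_bounds n).
have zE : z = (2^-1)%:C *: (x + z * z).
  apply: cconv_unique (cconvS uz) _.
  apply: (@cconv_le _ _ u _ z _ 1) uz => n /=.
  rewrite -scalerBr opprD addrACA subrr add0r cnormZR // subsq_mul.
  have h1 : cnorm (u n) <= 1 by apply: (le_trans (un n)); case: (sqrt_major_bounds n).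
  have := cnormD_le (u n * (u n - z)) ((u n - z) * z).
  have := cnormM_le (u n) (u n - z); have := cnormM_le (u n - z) z.
  have : cnorm (u n) * cnorm (u n - z) <= 1 * cnorm (u n - z).
    by rewrite ler_wpM2r // cnorm_ge0.
  have : cnorm (u n - z) * cnorm z <= cnorm (u n - z) * 1.
    by rewrite ler_wpM2l // cnorm_ge0.
  lra.
exists z; split => //.
- apply: cconv_unique (cconv_star uz) _ => //.
  have -> // : (fun n => star (u n)) = u.
  apply/funext; elim => [|n IH] /=; first exact: star0.
  by rewrite starZR starD starM IH xs.
- have /(congr1 (fun w => (2 : R)%:C *: w)) : z = (2^-1)%:C *: (x + z * z) by [].
  rewrite scalerA -rmorphM divff ?pnatr_eq0 // scale1r rmorph_nat scaler_nat => h.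
  by rewrite mulrBr mulr1 mulrBl mul1r -addrA -opprD addrA -mulr2n h addrK.
- move=> y xy; apply: (cconv_unique (cconvMr y uz)).
  have -> : (fun n => u n * y) = (fun n => y * u n).
    apply/funext; elim => [|n IH] /=; first by rewrite mul0r mulr0.
    by rewrite -scalerAl -scalerAr mulrDl mulrDr xy -mulrA IH mulrA IH mulrA.
  exact: cconvMl.
Qed.

End SquareRoot.

(** * The positive cone *)

Section PositiveCone.
Context {R : realType} {A : cstarAlgType R}.
Implicit Types (x y z h : A) (t : R).

(** Nonnegativity of the spectrum expressed by the norm alone: a spectrum in
    [0, 2 t] is one within [t] of the number [t].  In this form the cone is
    visibly convex; [positiveP] identifies it with the elements [y* y]. *)
Definition pcone x :=
  selfadjoint x /\ exists2 t : R, 0 <= t & cnorm (t%:C%:A - x) <= t.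

Lemma pcone_sa x : pcone x -> selfadjoint x. Proof. by case. Qed.

Lemma pcone0 : pcone 0.
Proof. by split; [exact: sa0 | exists 0; rewrite // subr0 scale0r cnorm0]. Qed.

Lemma pconeD x y : pcone x -> pcone y -> pcone (x + y).
Proof.
move=> [xs [t t0 ht]] [ys [s s0 hs]]; split; first exact: saD.
exists (t + s); first exact: addr_ge0.
rewrite rmorphD /= scalerDl opprD addrACA.
by rewrite (le_trans (cnormD_le _ _)) // lerD.
Qed.

Lemma pconeZ t x : 0 <= t -> pcone x -> pcone (t%:C *: x).
Proof.
move=> t0 [xs [s s0 hs]]; split; first exact: saZ.
exists (t * s); first exact: mulr_ge0.
by rewrite rmorphM /= -scalerA -scalerBr cnormZR // ler_wpM2l.
Qed.

Lemma pconeZr t x : 0 < t -> pcone (t%:C *: x) -> pcone x.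
Proof.
move=> t0 /(pconeZ (t := t^-1)); rewrite invr_ge0 (ltW t0) scalerA -rmorphM.
by rewrite mulVf ?gt_eqF // scale1r; apply.
Qed.

(** The square root taken inside the cone commutes with whatever its square
    commutes with; this is what makes the products of commuting positive
    elements positive. *)
Lemma pcone_sqrt x : pcone x ->
  exists h, [/\ pcone h, h * h = x & forall y, x * y = y * x -> h * y = y * h].
Proof.
move=> [xs [t t0 ht]]; have [t00|tn0] := eqVneq t 0.
  have -> : x = 0.
    move: ht; rewrite t00 scale0r sub0r cnormN => x0.
    by apply/eqP; rewrite -cnorm_eq0 eq_le x0 cnorm_ge0.
  by exists 0; split => [||y _]; [exact: pcone0 | rewrite mulr0|rewrite mul0r mulr0].
have tp : 0 < t by rewrite lt_def tn0.
pose x' : A := 1 - (t^-1)%:C *: x.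
have [] := @cstar_sqrt1 R A x'.
- by apply: saB; [exact: sa1 | exact: saZ].
- have -> : x' = (t^-1)%:C *: (t%:C%:A - x).
    by rewrite scalerBr scalerA -rmorphM mulVf // scale1r.
  by rewrite cnormZR ?invr_ge0 // ler_pdivrMl // mulr1.
move=> z [zs z1 zE zC]; exists ((Num.sqrt t)%:C *: (1 - z)); split.
- split; first by apply/saZ/saB => //; exact: sa1.
  exists (Num.sqrt t); first exact: sqrtr_ge0.
  rewrite -scalerBr opprB addrC subrK cnormZR ?sqrtr_ge0 //.
  by rewrite ler_piMr // sqrtr_ge0.
- rewrite -scalerAl -scalerAr scalerA -rmorphM -expr2 sqr_sqrtr // zE.
  by rewrite opprB addrC subrK scalerA -rmorphM mulfV // scale1r.
- move=> y xy; rewrite -scalerAl -scalerAr; congr (_ *: _).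
  rewrite mulrBl mulrBr mul1r mulr1 zC // /x' mulrBl mulrBr mul1r mulr1.
  by rewrite -scalerAl -scalerAr xy.
Qed.

Lemma star_imul x : star ('i *: x) = - ('i *: star x).
Proof. rewrite starZ -scaleNr; congr (_ *: _).
by apply/eqP; rewrite eq_complex /= oppr0 !eqxx. Qed.

Lemma scale_ii x : 'i *: ('i *: x) = - x :> A.
Proof. by rewrite scalerA -expr2 sqr_i scaleN1r. Qed.

Lemma scale_halfD x : (2^-1)%:C *: (x + x) = x.
Proof.
rewrite -mulr2n -scaler_nat scalerA -(rmorph_nat (real_complex R)) -rmorphM.
by rewrite mulVf ?scale1r // pnatr_eq0.
Qed.

(** Because [y + i h] is unitary. *)
Lemma commuting_circle_le1 y h : selfadjoint y -> selfadjoint h ->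
  y * h = h * y -> y * y + h * h = 1 -> cnorm y <= 1.
Proof.
move=> ys hs yh yh1; pose u := y + 'i *: h.
have us : star u = y - 'i *: h by rewrite starD star_imul ys hs.
have u1 : cnorm u = 1.
  apply/eqP; rewrite -(@eqrXn2 _ 2) ?cnorm_ge0 // expr1n -cnorm_star_mul us.
  rewrite mulrBl !mulrDr -!scalerAl -!scalerAr yh opprD addrA addrK scale_ii.
  by rewrite opprK yh1 cnorm1.
have -> : y = (2^-1)%:C *: (u + star u) by rewrite us addrACA subrr addr0 scale_halfD.
have h2 : 0 <= 2^-1 :> R by lra.
rewrite cnormZR //; have := cnormD_le u (star u); rewrite cnorm_star u1; lra.
Qed.

(** If [cnorm y <= 1] and [h] is the square root of [1 - y ^ 2], then
    [commuting_circle_le1] bounds [h], so that [1 - y ^ 2 = h ^ 2] has norm at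
    most [1]. *)
Lemma pcone_sq y : selfadjoint y -> pcone (y * y).
Proof.
move=> ys; wlog y1 : y ys / cnorm y <= 1 => [H|].
  have s0 : 0 < cnorm y + 1 by rewrite ltr_wpDl // cnorm_ge0.
  have si : 0 < (cnorm y + 1)^-1 by rewrite invr_gt0.
  have := H ((cnorm y + 1)^-1%:C *: y) (saZ _ ys).
  rewrite cnormZR ?(ltW si) // mulrC ler_pdivrMr // mul1r lerDl ler01.
  move/(_ isT); rewrite -scalerAl -scalerAr => /(pconeZr si).
  exact: pconeZr.
have [|h [hp hh hC]] := @pcone_sqrt (1 - y * y).
  split; first by apply: saB; [exact: sa1 | exact: sa_sq].
  exists 1; rewrite // scale1r opprB addrC subrK sa_normsq //.
  by rewrite expr_le1 // cnorm_ge0.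
have hy : h * y = y * h by apply: hC; rewrite mulrBl mulrBr mul1r mulr1 mulrA.
split; first exact: sa_sq.
exists 1; rewrite // scale1r -hh (sa_normsq (pcone_sa hp)) expr_le1 ?cnorm_ge0 //.
by apply: commuting_circle_le1 hy _ => //; [exact: pcone_sa | rewrite hh subrK].
Qed.

Lemma pconeM x y : pcone x -> pcone y -> x * y = y * x -> pcone (x * y).
Proof.
move=> /pcone_sqrt[h [hp <- hC]] /pcone_sqrt[k [kp <- kC]] C.
have hk : h * k = k * h by apply/esym/kC/esym/hC.
have -> : h * h * (k * k) = h * k * (h * k).
  by rewrite -!mulrA; congr (_ * _); rewrite !mulrA hk.
by apply/pcone_sq/saM => //; exact: pcone_sa.
Qed.

(** The product of [x] and [- x] is in the cone, hence of the form [c ^ 2] with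
    [c] commuting with [x]; then [x + i c] has square modulus
    [x ^ 2 + c ^ 2 = 0], so that the self-adjoint [x] is [- i c], which is
    skew-adjoint. *)
Lemma pcone_anti x : pcone x -> pcone (- x) -> x = 0.
Proof.
move=> xp np; have := pconeM xp np; rewrite mulrN mulNr => /(_ erefl).
move=> /pcone_sqrt[c [cp cc cC]].
have xs := pcone_sa xp; have cs := pcone_sa cp.
have xc : c * x = x * c by apply: cC; rewrite mulNr mulrN mulrA.
have : x + 'i *: c = 0.
  apply: cnorm0_eq0; apply/eqP; rewrite -sqrf_eq0 -cnorm_star_mul starD.
  rewrite star_imul xs cs mulrBl !mulrDr -!scalerAl -!scalerAr xc opprD addrA addrK.
  by rewrite scale_ii opprK cc subrr cnorm0.
move=> x0; have xE : x = - ('i *: c) by apply/eqP; rewrite -addr_eq0 x0.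
have := xs; rewrite /selfadjoint /= {1}xE starN star_imul cs opprK => xE'.
have : x + x = 0 by rewrite {1}xE -[X in _ + X]xE' addNr.
by move/(congr1 (fun w => (2^-1)%:C *: w)); rewrite scale_halfD scaler0.
Qed.

Lemma sa_pow2 x k : selfadjoint x -> 
  selfadjoint (x ^+ (2 ^ k)) /\ cnorm (x ^+ (2 ^ k)) = cnorm x ^+ (2 ^ k).
Proof.
move=> xs; elim: k => [|k [IHs IHn]]; first by rewrite !expr1.
rewrite expnS mulnC !exprM expr2; split; first exact: sa_sq.
by rewrite sa_normsq // IHn.
Qed.

Lemma cnormX_le x n : cnorm (x ^+ n) <= cnorm x ^+ n.
Proof.
elim: n => [|n IH]; first by rewrite !expr0 cnorm1.
rewrite !exprS (le_trans (cnormM_le _ _)) // ler_wpM2l // cnorm_ge0 //.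
Qed.

Lemma bernoulli_le (d : R) n : 0 <= d -> 1 + n%:R * d <= (1 + d) ^+ n.
Proof.
move=> d0; elim: n => [|n IH]; first by rewrite mul0r addr0 expr0.
rewrite exprS; apply: (@le_trans _ _ ((1 + d) * (1 + n%:R * d))).
  rewrite -natr1; have : 0 <= n%:R * (d * d) by rewrite !mulr_ge0 ?ler0n //.
  lra.
by rewrite ler_wpM2l // addr_ge0.
Qed.

Lemma exp2n_unbounded (s c : R) :
  (forall k, s ^+ (2 ^ k) <= 1 + (2 ^ k)%:R * c) -> s <= 1.
Proof.
move=> H; rewrite leNgt; apply/negP => s1.
pose d := s - 1; have d0 : 0 < d by rewrite subr_gt0.
have sE : s = 1 + d by rewrite addrC subrK.
have H2 k : (2 ^ k)%:R * d ^+ 2 <= 2 * c.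
  have mp : 0 < (2 ^ k)%:R :> R by rewrite ltr0n expn_gt0.
  have := bernoulli_le (2 ^ k) (ltW d0); rewrite -sE.
  have := H k.+1; rewrite expnS mulnC exprM natrM.
  move: mp; move: (s ^+ (2 ^ k)) ((2 ^ k)%:R : R) => w m mp; rewrite !expr2 => h1 h2.
  have md : 0 <= m * d by rewrite mulr_ge0 // ltW.
  have h3 : (1 + m * d) * (1 + m * d) <= w * w by nra.
  have h4 : m * (m * (d * d)) <= m * (2 * c) by lra.
  by move: h4; rewrite ler_pM2l.
have d2 : 0 < d ^+ 2 by rewrite exprn_gt0.
pose N := Num.bound (`|2 * c / d ^+ 2|).
have := archi_boundP (normr_ge0 (2 * c / d ^+ 2)); rewrite -/N => hN.
have := le_lt_trans (ler_norm _) hN; rewrite ltr_pdivrMr // => h.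
have : N%:R * d ^+ 2 <= (2 ^ N)%:R * d ^+ 2.
  by rewrite ler_wpM2r ?ltW // ltr_nat ltn_expl.
have := H2 N; lra.
Qed.

(** The powers of [1 + y y*] are [1 + sum_(i < n) y (1 + y* y) ^ i y*], hence
    grow at most linearly when [1 + y* y] is a contraction; the norm of a
    self-adjoint element is the growth rate of its powers of exponent [2 ^ k],
    so it is at most [1]. *)
Lemma swap_contraction y : cnorm (1 + star y * y) <= 1 ->
  cnorm (1 + y * star y) <= 1.
Proof.
move=> y1; set b := 1 + _.
have bs : selfadjoint b by apply: saD; [exact: sa1 | rewrite /selfadjoint /= starM starK].
have by_ n : b ^+ n * y = y * (1 + star y * y) ^+ n.
  elim: n => [|n IH]; first by rewrite !expr0 mulr1 mul1r.
  rewrite !exprSr -mulrA (_ : b * y = y * (1 + star y * y)).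
    by rewrite mulrA IH mulrA.
  by rewrite mulrDl mulrDr mul1r mulr1 mulrA.
have bn n : cnorm (b ^+ n) <= 1 + n%:R * (cnorm y ^+ 2).
  elim: n => [|n IH]; first by rewrite expr0 cnorm1 mul0r addr0.
  rewrite exprSr {2}/b mulrDr mulr1 mulrA by_.
  apply: (le_trans (cnormD_le _ _)); rewrite -natr1 mulrDl mul1r addrA lerD //.
  apply: (le_trans (cnormM_le _ _)); rewrite cnorm_star expr2 ler_wpM2r ?cnorm_ge0 //.
  apply: (le_trans (cnormM_le _ _)); rewrite ler_piMr ?cnorm_ge0 //.
  by apply: (le_trans (cnormX_le _ _)); rewrite exprn_ile1 ?cnorm_ge0.
apply: exp2n_unbounded => k.
by have [_ <-] := sa_pow2 k bs; exact: bn.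
Qed.

Lemma pcone_swap y : pcone (- (star y * y)) -> pcone (- (y * star y)).
Proof.
move=> [_ [t t0 ht]].
have ss : selfadjoint (- (y * star y)).
  by apply: saN; rewrite /selfadjoint /= starM starK.
split=> //.
pose t1 := t + 1; have t1p : 0 < t1 by rewrite ltr_wpDl.
pose s := (Num.sqrt t1)^-1.
have s0 : 0 <= s by rewrite invr_ge0 sqrtr_ge0.
have s2 : s * s = t1^-1 by rewrite -invfM -expr2 sqr_sqrtr // ltW.
have E (a b : A) : (s%:C *: a) * (s%:C *: b) = (t1^-1)%:C *: (a * b).
  by rewrite -scalerAl -scalerAr scalerA -rmorphM s2.
have N (a : A) : cnorm (1 + (t1^-1)%:C *: a) = t1^-1 * cnorm (t1%:C%:A + a).
  rewrite -cnormZR ?invr_ge0 ?ltW // scalerDr scalerA -rmorphM mulVf ?gt_eqF //.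
  by rewrite scale1r.
exists t1; first exact: ltW.
have := @swap_contraction (s%:C *: y); rewrite starZR !E !N.
rewrite !ler_pdivrMl // !mulr1 opprK; apply.
rewrite rmorphD /= scalerDl scale1r addrAC.
rewrite (le_trans (cnormD_le _ _)) // cnorm1 lerD2r.
by rewrite opprK in ht.
Qed.

End PositiveCone.

(** * Positive elements, order and norm *)

Section Positive.
Context {R : realType} {A : cstarAlgType R}.
Implicit Types (x y z a b c h : A) (t : R).

Lemma pcone_sum0 x y : pcone x -> pcone y -> x + y = 0 -> x = 0.
Proof.
move=> xp yp /eqP; rewrite addr_eq0 => /eqP xy.
by apply: pcone_anti => //; rewrite xy opprK.
Qed.

Lemma sa_sq_eq0 x : selfadjoint x -> x * x = 0 -> x = 0.
Proof.
move=> xs x0; apply/eqP; rewrite -cnorm_eq0 -sqrf_eq0 -sa_normsq //.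
by rewrite x0 cnorm0.
Qed.

(** For [b = |x| - x] one has [b x b = - |x| b ^ 2], minus the square of
    [c = sqrt |x| b]: compressing by [b] exhibits the negative part of [x]. *)
Lemma negative_part x : selfadjoint x -> exists b c,
  [/\ selfadjoint b, selfadjoint c, b * x * b = - (c * c) & c = 0 -> pcone x].
Proof.
move=> xs; have [a [ap aa aC]] := pcone_sqrt (pcone_sq xs).
have ax : a * x = x * a by apply: aC; rewrite mulrA.
have [k [kp kk kC]] := pcone_sqrt ap.
have as_ := pcone_sa ap; have ks := pcone_sa kp.
pose b := a - x; have bs : selfadjoint b by exact: saB.
have ab : a * b = b * a by rewrite mulrBl mulrBr ax.
have kb : k * b = b * k by apply: kC.
have bx : b * x = - (a * b) by rewrite mulrBl mulrBr aa opprB.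
have abb : a * b * b = k * b * (k * b).
  by rewrite -!mulrA (mulrA b k) -kb !mulrA kk.
exists b, (k * b); split => //; first exact: saM.
  by rewrite bx mulNr abb.
move=> c0.
have b2 : b * b = a * b + a * b by rewrite {2}/b mulrBr bx opprK -ab.
have b30 : b * b * b = 0.
  by rewrite b2 mulrDl abb c0 mulr0 addr0.
have b0 : b = 0.
  apply: sa_sq_eq0 => //; apply: sa_sq_eq0; first exact: sa_sq.
  by rewrite mulrA b30 mul0r.
by rewrite -(subrK a x) -(opprB a) -/b b0 oppr0 add0r.
Qed.

(** Twice this element is [(z* + z) ^ 2 + (i (z* - z)) ^ 2]. *)
Lemma gram_symm_pcone z : pcone (star z * z + z * star z).
Proof.
apply: (@pconeZr _ _ 2) => //.
pose h := z + star z; pose k := 'i *: (z - star z).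
have hs : selfadjoint h by rewrite /selfadjoint /= starD starK addrC.
have ks : selfadjoint k.
  by rewrite /selfadjoint /= star_imul starB starK -scalerN opprB.
have -> : (2 : R)%:C *: (star z * z + z * star z) = h * h + k * k.
  rewrite -scalerAl -scalerAr scale_ii rmorph_nat scaler_nat mulr2n.
  pose p := z * z + star z * star z; pose q := star z * z + z * star z.
  have -> : h * h = p + q 
    by rewrite mulrDl !mulrDr /p /q (AC (2*2) ((1*4)*(3*2))).
  have -> : (z - star z) * (z - star z) = p - q.
    rewrite mulrBl !mulrBr /p /q opprB opprD.
    by rewrite [LHS](AC (2*2) ((1*3)*(4*2))) .
  by rewrite -/q opprB [RHS]addrC [RHS]addrA subrK.
by apply: pconeD; exact: pcone_sq.
Qed.

(** If [x = y* y] had a negative part, compressing by [b] as in [negative_part]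
    would turn [z = y b] into an element with [- z* z] in the cone, hence with
    [- z z*] in the cone, whereas [z* z + z z*] is always in the cone. *)
Lemma pcone_gram y : pcone (star y * y).
Proof.
have xs : selfadjoint (star y * y) by rewrite /selfadjoint /= starM starK.
have [b [c [bs cs bxb]]] := negative_part xs; apply.
pose z := y * b; have zz : star z * z = - (c * c).
  by rewrite -bxb /z starM bs !mulrA.
have np : pcone (- (star z * z)) by rewrite zz opprK; exact: pcone_sq.
have np' := pcone_swap np.
have s0 : star z * z + z * star z = 0.
  apply: pcone_anti; first exact: gram_symm_pcone.
  by rewrite opprD; exact: pconeD.
apply: sa_sq_eq0 => //; apply/eqP; rewrite -[c * c]opprK -zz oppr_eq0; apply/eqP.
by rewrite -[LHS]opprK (pcone_sum0 np np') ?oppr0 // -opprD s0 oppr0.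
Qed.

Lemma positiveP x : positive x <-> pcone x.
Proof.
split; first by case=> y ->; exact: pcone_gram.
by move=> /pcone_sqrt[h [/pcone_sa hs <- _]]; exists h; rewrite hs.
Qed.

Lemma positive_sa x : positive x -> selfadjoint x.
Proof. by move=> /positiveP/pcone_sa. Qed.

Lemma positive0 : positive (0 : A). Proof. exact/positiveP/pcone0. Qed.

Lemma positiveD x y : positive x -> positive y -> positive (x + y).
Proof. by rewrite !positiveP; exact: pconeD. Qed.

Lemma positive_sum (I : Type) (r : seq I) (F : I -> A) :
  (forall i, positive (F i)) -> positive (\sum_(i <- r) F i).
Proof. by move=> H; apply: big_ind => //; [exact: positive0 | exact: positiveD]. Qed.

Lemma positiveZ t x : 0 <= t -> positive x -> positive (t%:C *: x).
Proof. by rewrite !positiveP; exact: pconeZ. Qed.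

Lemma positiveZr t x : 0 < t -> positive (t%:C *: x) -> positive x.
Proof. by rewrite !positiveP; exact: pconeZr. Qed.

Lemma positiveR t : 0 <= t -> positive (t%:C%:A : A).
Proof. by move=> t0; apply: positiveZ => //; exists 1; rewrite star1 mulr1. Qed.

Lemma positive_anti x : positive x -> positive (- x) -> x = 0.
Proof. by rewrite !positiveP; exact: pcone_anti. Qed.

Lemma positiveM x y : positive x -> positive y -> x * y = y * x ->
  positive (x * y).
Proof. by rewrite !positiveP; exact: pconeM. Qed.

Lemma positive_gram x : positive (star x * x). Proof. by exists x. Qed.

Lemma positive_conj c x : positive x -> positive (star c * x * c).
Proof. by case=> y ->; exists (y * c); rewrite starM !mulrA. Qed.

Lemma positive_near x t : selfadjoint x -> 0 <= t ->
  cnorm (t%:C%:A - x) <= t -> positive x.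
Proof. by move=> xs t0 h; apply/positiveP; split=> //; exists t. Qed.

Lemma positive_norm x : selfadjoint x -> positive ((cnorm x)%:C%:A - x).
Proof.
move=> xs; apply: (@positive_near _ (cnorm x)); rewrite ?cnorm_ge0 //.
  by apply: saB => //; exact: saR.
by rewrite opprB addrC subrK.
Qed.

Lemma positive_normN x : selfadjoint x -> positive ((cnorm x)%:C%:A + x).
Proof. by move=> /saN/positive_norm; rewrite opprK cnormN. Qed.

(** After division by [t], [- 1 <= y <= 1]; then [1 - y ^ 2] is a product of
    commuting positive elements, so that [y] is the real part of a unitary. *)
Lemma cnorm_lt_order x t : positive (t%:C%:A - x) -> positive (t%:C%:A + x) ->
  0 < t -> cnorm x <= t.
Proof.
move=> p1 p2 tp.
have xs : selfadjoint x.
  by have /positive_sa/(saB (saR t)) := p1; rewrite opprB addrC subrK.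
pose y := (t^-1)%:C *: x; have ti : 0 <= t^-1 by rewrite invr_ge0 ltW.
have ys : selfadjoint y by exact: saZ.
have E e : 1 + e *: y = (t^-1)%:C *: (t%:C%:A + e *: x).
  by rewrite scalerDr !scalerA -rmorphM mulVf ?gt_eqF // scale1r (mulrC e).
have q1 : positive (1 - y) by have := E (-1); rewrite !scaleN1r => ->; exact: positiveZ.
have q2 : positive (1 + y) by have := E 1; rewrite !scale1r => ->; exact: positiveZ.
have yy1 : (1 - y) * (1 + y) = 1 - y * y.
  by rewrite mulrBl mul1r mulrDr mulr1 opprD addrA addrK.
have yy2 : (1 + y) * (1 - y) = 1 - y * y.
  by rewrite mulrDl mul1r mulrBr mulr1 addrA subrK.
have := positiveM q1 q2; rewrite yy1 yy2 => /(_ erefl)/positiveP/pcone_sqrt.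
move=> [h [/pcone_sa hs hh hC]].
have hy : h * y = y * h by apply: hC; rewrite mulrBl mulrBr mul1r mulr1 mulrA.
have := @commuting_circle_le1 _ _ y h ys hs (esym hy).
rewrite hh addrC subrK => /(_ erefl).
by rewrite cnormZR // ler_pdivrMl // mulr1.
Qed.

Lemma cnorm_le_order x t : positive (t%:C%:A - x) -> positive (t%:C%:A + x) ->
  0 <= t -> cnorm x <= t.
Proof.
move=> p1 p2 t0; apply/ler_addgt0Pr => e e0; apply: cnorm_lt_order.
- by rewrite rmorphD scalerDl addrAC; apply/positiveD/positiveR/ltW.
- by rewrite rmorphD scalerDl addrAC; apply/positiveD/positiveR/ltW.
- exact: ltr_wpDl.
Qed.

Lemma cnorm_le_positive x y : positive x -> positive (y - x) ->
  cnorm x <= cnorm y.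
Proof.
move=> xp xy; have ys : selfadjoint y.
  by rewrite -(subrK x y); apply: positive_sa; exact: positiveD.
apply: cnorm_le_order; rewrite ?cnorm_ge0 //.
- by rewrite -(subrKA y); apply: positiveD => //; exact: positive_norm.
- by apply: positiveD => //; apply: positiveR; exact: cnorm_ge0.
Qed.

(** At the fixed radius [cnorm x + 1], membership in the cone is a norm bound,
    and norm bounds pass to the limit. *)
Lemma positive_archimedean x : selfadjoint x ->
  (forall e : R, 0 < e -> positive (e%:C%:A + x)) -> positive x.
Proof.
move=> xs H; have [t tE] : exists t, t = cnorm x + 1 by exists (cnorm x + 1).
have t0 : 0 <= t by rewrite tE addr_ge0 // cnorm_ge0.
apply: (@positive_near _ t) => //; apply/ler_addgt0Pr => e e0.
wlog e1 : e e0 / e <= 1 => [W|].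
  have m0 : 0 < Num.min e 1 by rewrite lt_min e0 ltr01.
  have := W _ m0; rewrite ge_min lexx orbT => /(_ isT)/le_trans; apply.
  by rewrite lerD2l ge_min lexx.
have -> : t%:C%:A - x = (t%:C%:A - (e%:C%:A + x)) + e%:C%:A.
  by rewrite opprD addrA addrAC subrK.
apply: (le_trans (cnormD_le _ _)); rewrite cnormR ?(ltW e0) // lerD2r.
apply: cnorm_le_order => //.
  by rewrite opprB addrC subrK; exact: H.
have -> : t%:C%:A + (t%:C%:A - (e%:C%:A + x)) =
    (t + 1 - e)%:C%:A + ((cnorm x)%:C%:A - x).
  rewrite [RHS]addrA -[in RHS]scalerDl -rmorphD (_ : t + 1 - e + cnorm x = t + t - e).
    by rewrite /= rmorphB rmorphD /= scalerBl scalerDl opprD !addrA.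
  by rewrite tE; ring.
apply: positiveD; last exact: positive_norm.
by apply: positiveR; rewrite tE; have := cnorm_ge0 x; lra.
Qed.

Lemma positiveR_ge0 t : positive (t%:C%:A : A) -> 0 <= t.
Proof.
move=> tp; rewrite leNgt; apply/negP => t0.
have := @positiveR (- t); rewrite oppr_ge0 ltW // => /(_ isT).
rewrite rmorphN scaleNr => /(positive_anti tp)/(congr1 (@cnorm R A)).
rewrite cnorm0 cnormZ normcR cnorm1 mulr1 => /eqP.
by rewrite normr_eq0 lt_eqF.
Qed.

Definition cRe x := (2^-1)%:C *: (x + star x).
Definition cIm x := (2^-1)%:C *: (- ('i *: (x - star x))).

Lemma cRe_sa x : selfadjoint (cRe x).
Proof. by apply: saZ; rewrite /selfadjoint /= starD starK addrC. Qed.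

Lemma cIm_sa x : selfadjoint (cIm x).
Proof.
apply: saZ; apply: saN.
by rewrite /selfadjoint /= star_imul starB starK -scalerN opprB.
Qed.

Lemma cReIm x : x = cRe x + 'i *: cIm x.
Proof.
rewrite /cIm scalerA mulrC -scalerA -scalerDr scalerN scale_ii opprK.
by rewrite addrACA subrr addr0 scale_halfD.
Qed.

Lemma cRe_id x : selfadjoint x -> cRe x = x.
Proof. by move=> xs; rewrite /cRe xs scale_halfD. Qed.

Lemma cIm_sa0 x : selfadjoint x -> cIm x = 0.
Proof. by move=> xs; rewrite /cIm xs subrr scaler0 oppr0 scaler0. Qed.

Lemma cRe_imul x : cRe ('i *: x) = - cIm x.
Proof. by rewrite /cRe /cIm star_imul -scalerBr -scalerN opprK. Qed.

Lemma cIm_imul x : cIm ('i *: x) = cRe x.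
Proof. by rewrite /cRe /cIm star_imul opprK -scalerDr scale_ii opprK. Qed.

Lemma cReD x y : cRe (x + y) = cRe x + cRe y.
Proof. by rewrite /cRe starD addrACA scalerDr. Qed.

Lemma cReZ t x : cRe (t%:C *: x) = t%:C *: cRe x.
Proof. by rewrite /cRe starZR -scalerDr !scalerA mulrC. Qed.

Lemma cImD x y : cIm (x + y) = cIm x + cIm y.
Proof. by apply/oppr_inj; rewrite -cRe_imul scalerDr cReD !cRe_imul opprD. Qed.

Lemma cImZ t x : cIm (t%:C *: x) = t%:C *: cIm x.
Proof.
apply/oppr_inj.
by rewrite -cRe_imul scalerA mulrC -scalerA cReZ cRe_imul scalerN.
Qed.

Lemma cnorm_cIm_le x : cnorm (cIm x) <= cnorm x.
Proof.
have h2 : 0 <= 2^-1 :> R by lra.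
rewrite /cIm cnormZR // cnormN cnormZ.
have -> : Normc.normc ('i : R[i]) = 1 by rewrite /= expr0n expr1n add0r sqrtr1.
by have := cnormB_le x (star x); rewrite cnorm_star mul1r; lra.
Qed.

End Positive.

(** * Extreme points for maps into complete ordered spaces *)

(** Comparable elements need not be self-adjoint: both for the complex numbers
    and for an injective envelope the order is that of a cone of differences, so
    that bounded sets lie in a translate of the self-adjoint part and one notion
    serves for both. *)
Record complete_order (R : realType) (W : lmodType R[i])
    (le : W -> W -> Prop) : Prop := CompleteOrder {
  ole_refl : forall x, le x x;
  ole_anti : forall x y, le x y -> le y x -> x = y;
  ole_trans : forall y x z, le x y -> le y z -> le x z;
  oleD2r : forall z x y, le x y -> le (x + z) (y + z);
  oleZ : forall (t : R) x y, 0 <= t -> le x y -> le (t%:C *: x) (t%:C *: y);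
  ole_inf : forall S : set W, S !=set0 -> (exists l, forall s, S s -> le l s) ->
    exists m, (forall s, S s -> le m s) /\
              (forall l, (forall s, S s -> le l s) -> le l m) }.

Section Sublinear.
Context {R : realType} {V W : lmodType R[i]} {le : W -> W -> Prop}.
Hypothesis leW : complete_order le.
Implicit Types (p q r : V -> W) (x y z : V) (a b c l m v w : W) (t s : R).

Let le_refl := ole_refl leW.
Let le_trans := ole_trans leW.

Definition real_linear (f : V -> W) :=
  (forall x y, f (x + y) = f x + f y) /\
  (forall t x, f (t%:C *: x) = t%:C *: f x).

Definition sublinear p :=
  (forall x y, le (p (x + y)) (p x + p y)) /\
  (forall t x, 0 <= t -> p (t%:C *: x) = t%:C *: p x).

Definition dominates p (f : V -> W) := forall x, le (f x) (p x).

Lemma oleD a b c d : le a b -> le c d -> le (a + c) (b + d).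
Proof.
move=> ab cd; apply: le_trans (oleD2r leW c ab) _.
by rewrite ![b + _]addrC; exact: oleD2r.
Qed.

Lemma ole_subl a b c : le (a - b) c <-> le a (c + b).
Proof.
by split=> [/(oleD2r leW b)|/(oleD2r leW (- b))]; rewrite ?subrK ?addrK.
Qed.

Lemma ole_subr a b c : le a (c - b) <-> le (a + b) c.
Proof.
by split=> [/(oleD2r leW b)|/(oleD2r leW (- b))]; rewrite ?subrK ?addrK.
Qed.

Lemma oleN a b : le a b -> le (- b) (- a).
Proof. by move=> ab; rewrite -[- b]add0r ole_subl addrC ole_subr add0r. Qed.

Lemma sublinear0 p : sublinear p -> p 0 = 0.
Proof. by move=> [_ /(_ 0 0 (lexx 0))]; rewrite !scale0r. Qed.

Lemma sublinearN p x : sublinear p -> le (- p (- x)) (p x).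
Proof.
move=> ps; have [/(_ x (- x)) h _] := ps; move: h.
by rewrite subrr sublinear0 // -ole_subl sub0r.
Qed.

(** Homogeneity need only be checked as an inequality, since [t^-1] scales
    back. *)
Lemma sublinearI p : (forall x y, le (p (x + y)) (p x + p y)) -> p 0 = 0 ->
  (forall t x, 0 < t -> le (t%:C *: p x) (p (t%:C *: x))) -> sublinear p.
Proof.
move=> pD p0 pZ; split=> // t x; rewrite le_eqVlt => /predU1P[<-|t0].
  by rewrite !scale0r p0.
apply: (ole_anti leW); last exact: pZ.
have ti : 0 < t^-1 by rewrite invr_gt0.
have := oleZ leW (ltW t0) (pZ _ (t%:C *: x) ti).
by rewrite !scalerA -!rmorphM mulfV ?mulVf ?gt_eqF // !scale1r.
Qed.

Lemma real_linearN f x : real_linear f -> f (- x) = - f x.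
Proof.
move=> [_ /(_ (-1) x)]; rewrite rmorphN rmorph1 !scaleN1r //.
Qed.

Lemma dominates_linear_eq f g : real_linear f -> real_linear g ->
  dominates f g -> g = f.
Proof.
move=> fl gl fg; apply/funext => x; apply: (ole_anti leW) => //.
by have := oleN (fg (- x)); rewrite !real_linearN // !opprK.
Qed.

Lemma ole_inf2 (S T : set W) a b m :
  (forall l, (forall w, S w -> le l w) -> le l a) ->
  (forall l, (forall w, T w -> le l w) -> le l b) ->
  (forall v w, S v -> T w -> le m (v + w)) -> le m (a + b).
Proof.
move=> Sa Tb H; rewrite addrC -ole_subl; apply: Tb => w Tw.
rewrite ole_subl addrC -ole_subl; apply: Sa => v Sv; rewrite ole_subl.
exact: H.
Qed.

(** A sublinear [q] below [p] cuts out a face of the convex set of the real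
    linear maps dominated by [p]. *)
Definition facial p q := dominates p q /\
  forall f g t, real_linear f -> real_linear g -> dominates p f ->
    dominates p g -> 0 < t < 1 ->
    (forall x, le (t%:C *: f x + (1 - t)%:C *: g x) (q x)) ->
    dominates q f /\ dominates q g.

Lemma facial_refl p : facial p p.
Proof. by split=> // x; exact: le_refl. Qed.

(** For [r y = inf {q (y + s x) - s (q x) | s >= 0}], the linear maps dominated
    by [r] are those dominated by [q] that take the largest possible value [q x]
    at [x].  They form a face because a convex combination of two values reaches
    their common upper bound only if both do. *)
Lemma pin_face p q x : sublinear q -> facial p q ->
  exists r, [/\ sublinear r, facial p r, dominates q r & le (r (- x)) (- q x)].
Proof.
move=> qs [pq qF]; have [qD qZ] := qs.
pose S y : set W := [set q (y + s%:C *: x) - s%:C *: q x | s in [set s | 0 <= s]].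
have S0 y : S y (q y) by exists 0; rewrite //= !scale0r addr0 subr0.
have /boolp.choice[r rP] y : exists m, (forall w, S y w -> le m w) /\
    (forall l, (forall w, S y w -> le l w) -> le l m).
  apply: (ole_inf leW); first by exists (q y).
  exists (- q (- y)) => _ [s /= s0 <-]; rewrite ole_subr addrC ole_subl -qZ //.
  by apply: le_trans (qD _ _); rewrite addrAC subrr add0r; exact: le_refl.
have rq : dominates q r by move=> y; exact: (rP y).1.
have rs : sublinear r.
  apply: sublinearI => [y z||t y t0].
  - apply: (ole_inf2 (rP y).2 (rP z).2) => _ _ [s /= s0 <-] [s' /= s'0 <-].
    apply: le_trans ((rP (y + z)).1 _ _) _.
      by exists (s + s'); rewrite //= addr_ge0.
    rewrite addrACA -opprD -scalerDl -rmorphD; apply: (oleD2r leW).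
    by apply: le_trans (qD _ _); rewrite rmorphD scalerDl addrACA; exact: le_refl.
  - apply: (ole_anti leW); first by have := rq 0; rewrite (sublinear0 qs).
    apply: (rP 0).2 => _ [s /= s0 <-]; rewrite add0r qZ // subrr; exact: le_refl.
  - apply: (rP _).2 => _ [s /= s0 <-].
    have -> : q (t%:C *: y + s%:C *: x) - s%:C *: q x =
        t%:C *: (q (y + (s / t)%:C *: x) - (s / t)%:C *: q x).
      have ts : t * (s / t) = s by rewrite mulrCA mulfV ?mulr1 // gt_eqF.
      rewrite scalerBr scalerA -rmorphM ts -(qZ t) ?ltW //.
      by rewrite scalerDr scalerA -rmorphM ts.
    apply: (oleZ leW (ltW t0)); apply: (rP y).1.
    by exists (s / t); rewrite //= divr_ge0 // ltW.
exists r; split=> //; last first.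
  apply: (rP _).1; exists 1; rewrite //= rmorph1 !scale1r addNr (sublinear0 qs).
  by rewrite sub0r.
split=> [y|f g t fl gl pf pg t01 fg]; first exact: le_trans (rq y) (pq y).
have [|qf qg] := qF f g t fl gl pf pg t01.
  by move=> y; exact: le_trans (fg y) (rq y).
have /andP[t0 t1] := t01; have t1' : 0 < 1 - t by rewrite subr_gt0.
(* [q x] is at most an average of [f x] and [g x], which are at most [q x] *)
have fgx : le (q x) (t%:C *: f x + (1 - t)%:C *: g x).
  have h := le_trans (fg (- x)) ((rP (- x)).1 (- q x) _).
  have : le (- (t%:C *: f x + (1 - t)%:C *: g x)) (- q x).
    rewrite opprD -!scalerN -(real_linearN x fl) -(real_linearN x gl); apply: h.
    by exists 1; rewrite //= rmorph1 !scale1r addNr (sublinear0 qs) sub0r.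
  by move/oleN; rewrite !opprK.
have qxE : q x = t%:C *: q x + (1 - t)%:C *: q x.
  by rewrite -scalerDl -rmorphD addrC subrK rmorph1 scale1r.
have cancelZ u a b : 0 < u -> le (u%:C *: a) (u%:C *: b) -> le a b.
  move=> u0 /(@oleZ _ _ _ leW u^-1 _ _); rewrite invr_ge0 ltW // => /(_ isT).
  by rewrite !scalerA -!rmorphM mulVf ?gt_eqF // !scale1r.
have fx : le (q x) (f x).
  apply: (cancelZ t) => //; have := oleD fgx (oleN (oleZ leW (ltW t1') (qg x))).
  by rewrite {1}qxE addrK addrK.
have gx : le (q x) (g x).
  apply: (cancelZ (1 - t)) => //; have := oleD fgx (oleN (oleZ leW (ltW t0) (qf x))).
  by rewrite {1}qxE ![t%:C *: _ + _]addrC !addrK.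
suff D h : real_linear h -> dominates q h -> le (q x) (h x) -> dominates r h.
  by split; apply: D.
move=> [hD hZ] qh xh y; apply: (rP y).2 => _ [s /= s0 <-].
rewrite ole_subr; apply: le_trans (qh _); rewrite hD hZ.
by apply: oleD; [exact: le_refl | exact: oleZ].
Qed.

(** Subadditivity survives because two members of a chain are comparable, so
    that the smaller of them can be used at both points. *)
Lemma facial_chain_inf p q0 (S : set (V -> W)) : sublinear p -> S q0 ->
  (forall q, S q -> sublinear q /\ facial p q) ->
  (forall q r, S q -> S r -> dominates q r \/ dominates r q) ->
  exists m : V -> W, [/\ sublinear m, facial p m & forall q, S q -> dominates q m].
Proof.
move=> ps Sq0 SP St.
have /boolp.choice[m mP] x : exists w,
    (forall v, [set q x | q in S] v -> le w v) /\
    (forall l, (forall v, [set q x | q in S] v -> le l v) -> le l w).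
  apply: (ole_inf leW); first by exists (q0 x), q0.
  exists (- p (- x)) => _ [q /SP[qs [pq _]] <-].
  by apply: le_trans (sublinearN x qs); apply: oleN.
have mq q : S q -> dominates q m by move=> Sq x; apply: (mP x).1; exists q.
exists m; split=> //.
  apply: sublinearI => [x y||t x t0].
  - apply: (ole_inf2 (mP x).2 (mP y).2) => _ _ [q Sq <-] [r Sr <-].
    have [qr|rq] := St q r Sq Sr.
      apply: le_trans (mq r Sr _) _; apply: le_trans ((SP r Sr).1.1 _ _) _.
      by apply: oleD => //; exact: le_refl.
    apply: le_trans (mq q Sq _) _; apply: le_trans ((SP q Sq).1.1 _ _) _.
    by apply: oleD => //; exact: le_refl.
  - apply: (ole_anti leW).
      by have := mq _ Sq0 0; rewrite (sublinear0 (SP _ Sq0).1).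
    apply: (mP 0).2 => _ [q Sq <-]; rewrite (sublinear0 (SP _ Sq).1).
    exact: le_refl.
  - apply: (mP _).2 => _ [q Sq <-]; rewrite ((SP _ Sq).1.2 _ _ (ltW t0)).
    by apply: (oleZ leW (ltW t0)); exact: mq.
split=> [x|f g t fl gl pf pg t01 fg].
  by apply: le_trans (mq q0 Sq0 x) _; exact: (SP _ Sq0).2.1.
have H q : S q -> dominates q f /\ dominates q g.
  move=> Sq; apply: ((SP q Sq).2.2 f g t) => // x.
  exact: le_trans (fg x) (mq _ Sq x).
by split=> x; apply: (mP x).2 => _ [q Sq <-]; have [] := H q Sq.
Qed.

(** The Hahn-Banach-Kantorovich and Krein-Milman theorems at once.  A minimal
    facial sublinear map equals each of its refinements by [pin_face], which
    forces it to be odd, hence linear; and a face consisting of one linear map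
    is an extreme point. *)
Theorem sublinear_extreme p x0 : sublinear p -> exists f,
  [/\ real_linear f, dominates p f, f x0 = p x0 &
    forall g h t, real_linear g -> real_linear h -> dominates p g ->
      dominates p h -> 0 < t < 1 ->
      (forall x, f x = t%:C *: g x + (1 - t)%:C *: h x) -> g = f /\ h = f].
Proof.
move=> ps; have [q0 [q0s q0F pq0 q0x]] := pin_face x0 ps (facial_refl p).
pose T := {q : V -> W | [/\ sublinear q, facial p q & dominates q0 q]}.
pose leT (a b : T) := `[< dominates (sval a) (sval b) >].
have t0 : T by exists q0; split=> // x; exact: le_refl.
have [a|a b c /asboolP ab /asboolP bc|S St|[q [qs qF qq0]] qM] :=
  @ZL_preorder T t0 leT.
- by apply/asboolP => x; exact: le_refl.
- by apply/asboolP => x; exact: le_trans (bc x) (ab x).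
- have [[a Sa]|S0] := pselect (S !=set0); last first.
    by exists t0 => s Ss; case: S0; exists s.
  have [||||m [ms mF mS]] := @facial_chain_inf p (sval a) [set sval b | b in S].
  + exact: ps.
  + by exists a.
  + by move=> _ [[q []] ? ? ? _ <-].
  + move=> _ _ [b Sb <-] [c Sc <-].
    by have [/asboolP|/asboolP] := St b c Sb Sc; [left | right].
  have q0m : dominates q0 m.
    move=> x; apply: le_trans (mS (sval a) _ x) _; first by exists a.
    by case: (svalP a) => _ _; apply.
  exists (exist _ m (And3 ms mF q0m)) => s Ss; apply/asboolP.
  by apply: mS; exists s.
have qN x : q (- x) = - q x.
  have [r [rs rF qr rx]] := pin_face x qs qF.
  have q0r : dominates q0 r by move=> y; exact: le_trans (qr y) (qq0 y).
  have /asboolP/= rq : leT (exist _ r (And3 rs rF q0r)) (exist _ q (And3 qs qF qq0)).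
    by apply: qM; apply/asboolP.
  apply: (ole_anti leW); first exact: le_trans (rq _) rx.
  by have := sublinearN (- x) qs; rewrite opprK.
have [qD qZ] := qs.
have ql : real_linear q.
  split=> [x y|t x].
    apply: (ole_anti leW) => //.
    by have := oleN (qD (- x) (- y)); rewrite -opprD !qN !opprK opprD !opprK.
  have [t1|t1] := leP 0 t; first exact: qZ.
  rewrite -[t]opprK rmorphN !scaleNr qN qZ //.
  by rewrite oppr_ge0 ltW.
exists q; split=> //; first exact: qF.1.
  apply: (ole_anti leW); first exact: qF.1.
  have := oleN (le_trans (qq0 (- x0)) q0x).
  by rewrite qN !opprK.
move=> g h t gl hl pg ph t01 qE.
have [|qg qh] := qF.2 g h t gl hl pg ph t01.
  by move=> x; rewrite -qE; exact: le_refl.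
by split; apply: dominates_linear_eq.
Qed.

End Sublinear.

(** * Positive extensions from an operator system *)

Section LinearOn.
Context {R : realType} {V W : lmodType R[i]}.
Implicit Types (E : set V) (f : V -> W).

Definition subspace E := E 0 /\ forall (a : R[i]) x y, E x -> E y -> E (a *: x + y).

Definition linear_on E f :=
  forall (a : R[i]) x y, E x -> E y -> f (a *: x + y) = a *: f x + f y.

Lemma subspaceT : subspace [set: V]. Proof. by []. Qed.

Variables (E : set V) (f : V -> W).
Hypotheses (sE : subspace E) (fl : linear_on E f).

Lemma subspaceZ (a : R[i]) x : E x -> E (a *: x).
Proof. by move=> Ex; have := sE.2 a x 0 Ex sE.1; rewrite addr0. Qed.

Lemma subspaceD x y : E x -> E y -> E (x + y).
Proof. by move=> Ex Ey; have := sE.2 1 x y Ex Ey; rewrite scale1r. Qed.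

Lemma subspaceN x : E x -> E (- x).
Proof. by move=> Ex; rewrite -scaleN1r; exact: subspaceZ. Qed.

Lemma subspaceB x y : E x -> E y -> E (x - y).
Proof. by move=> Ex Ey; apply: subspaceD => //; exact: subspaceN. Qed.

Lemma linear_on0 : f 0 = 0.
Proof.
have := fl 1 sE.1 sE.1; rewrite !scale1r addr0 => /eqP.
by rewrite -subr_eq0 opprD addrA subrr sub0r oppr_eq0 => /eqP.
Qed.

Lemma linear_onD x y : E x -> E y -> f (x + y) = f x + f y.
Proof. by move=> Ex Ey; have := fl 1 Ex Ey; rewrite !scale1r. Qed.

Lemma linear_onZ (a : R[i]) x : E x -> f (a *: x) = a *: f x.
Proof. by move=> Ex; have := fl a Ex sE.1; rewrite !addr0 linear_on0 addr0. Qed.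

Lemma linear_onN x : E x -> f (- x) = - f x.
Proof. by move=> Ex; rewrite -scaleN1r linear_onZ // scaleN1r. Qed.

Lemma linear_onB x y : E x -> E y -> f (x - y) = f x - f y.
Proof.
by move=> Ex Ey; rewrite linear_onD ?linear_onN //; exact: subspaceN.
Qed.

End LinearOn.

Section OperatorSystem.
Context {R : realType} {A : cstarAlgType R}.
Variable E : set A.
Hypothesis sE : operator_system E.

Lemma operator_system_subspace : subspace E.
Proof.
have [E1 EL _] := sE; split=> //.
by have := EL (-1) _ _ E1 E1; rewrite scaleN1r addNr.
Qed.
Let sE' := operator_system_subspace.

Lemma operator_system_star x : E x -> E (star x).
Proof. by case: sE => _ _; apply. Qed.

Lemma operator_system_R (t : R) : E t%:C%:A.
Proof. by case: sE => E1 _ _; exact: subspaceZ. Qed.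

Lemma operator_system_Re x : E x -> E (cRe x).
Proof.
by move=> Ex; apply: subspaceZ => //; apply: subspaceD => //; exact: operator_system_star.
Qed.

Lemma operator_system_Im x : E x -> E (cIm x).
Proof.
move=> Ex; apply: subspaceZ => //; apply: subspaceN => //; apply: subspaceZ => //.
by apply: subspaceB => //; exact: operator_system_star.
Qed.

Lemma linear_on_ReIm (W : lmodType R[i]) (f : A -> W) x : linear_on E f -> E x ->
  f x = f (cRe x) + 'i *: f (cIm x).
Proof.
move=> fl Ex; have ER := operator_system_Re Ex; have EI := operator_system_Im Ex.
have EiI := subspaceZ sE' 'i EI.
by rewrite {1}(cReIm x) (linear_onD fl ER EiI) (linear_onZ sE' fl 'i EI).
Qed.

Lemma linear_on_eq_sa (W : lmodType R[i]) (f g : A -> W) :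
  linear_on E f -> linear_on E g ->
  (forall x, E x -> selfadjoint x -> f x = g x) -> forall x, E x -> f x = g x.
Proof.
move=> fl gl fg x Ex; rewrite (linear_on_ReIm fl Ex) (linear_on_ReIm gl Ex).
have ER := operator_system_Re Ex; have EI := operator_system_Im Ex.
by rewrite !fg //; [exact: cIm_sa | exact: cRe_sa].
Qed.

End OperatorSystem.

Lemma operator_systemT (R : realType) (A : cstarAlgType R) :
  operator_system [set: A].
Proof. by []. Qed.

Section PositiveExtension.
Context {R : realType} {A : cstarAlgType R} {W : lmodType R[i]}.
Context {le : W -> W -> Prop}.
Hypothesis leW : complete_order le.
Variables (E : set A) (phi : A -> W).
Hypotheses (sE : operator_system E) (phil : linear_on E phi).
Hypothesis phi_ge0 : forall x, E x -> positive x -> le 0 (phi x).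

Let sE' := operator_system_subspace sE.
Let le_refl := ole_refl leW.
Let le_trans := ole_trans leW.

Definition positive_extensions : set (A -> W) :=
  [set Phi | [/\ linear_on [set: A] Phi, forall x, positive x -> le 0 (Phi x) &
     forall x, E x -> Phi x = phi x]].

Lemma linear_on_le x y : E x -> E y -> positive (y - x) -> le (phi x) (phi y).
Proof.
move=> Ex Ey xy; have := phi_ge0 (subspaceB sE' Ey Ex) xy.
by rewrite (linear_onB sE' phil) // (ole_subr leW) add0r.
Qed.

Lemma real_linear_complexify (f : A -> W) : real_linear f ->
  linear_on [set: A] (fun x => f (cRe x) + 'i *: f (cIm x)).
Proof.
move=> [fD fZ] [u v] x y _ _.
have -> : (u +i* v)%C *: x + y = u%:C *: x + (v%:C *: ('i *: x) + y).
  rewrite addrA scalerA -scalerDl; congr (_ *: _ + _).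
  by apply/eqP; rewrite eq_complex /= !(mul0r, mulr0, mulr1, addr0, add0r, subr0) !eqxx.
have ReE : cRe (u%:C *: x + (v%:C *: ('i *: x) + y)) =
    u%:C *: cRe x + (- (v%:C *: cIm x) + cRe y).
  by rewrite !cReD !cReZ cRe_imul scalerN.
have ImE : cIm (u%:C *: x + (v%:C *: ('i *: x) + y)) =
    u%:C *: cIm x + (v%:C *: cRe x + cIm y).
  by rewrite !cImD !cImZ cIm_imul.
rewrite ReE ImE !fD real_linearN //.
rewrite (fZ u (cRe x)) (fZ v (cIm x)) (fZ u (cIm x)) (fZ v (cRe x)).
have -> : (u +i* v)%C = u%:C + v%:C * 'i.
  by apply/eqP; rewrite eq_complex /= !(mul0r, mulr0, mulr1, addr0, add0r, subr0) !eqxx.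
have vii : v%:C * 'i * 'i = - v%:C :> R[i] by rewrite -mulrA -expr2 sqr_i mulrN1.
move: (f (cRe x)) (f (cIm x)) (f (cRe y)) (f (cIm y)) => a b c d.
rewrite !scalerDl !scalerDr !scalerA vii scaleNr.
rewrite (mulrC ('i : R[i]) u%:C) (mulrC ('i : R[i]) v%:C).
by rewrite [LHS](AC ((1*2)*(1*2)) ((1*4*(5*2))*(3*6))).
Qed.

Lemma real_linear_Re (Phi : A -> W) : linear_on [set: A] Phi ->
  real_linear (fun x => Phi (cRe x)).
Proof.
move=> Pl; split=> [x y|t x]; first by rewrite cReD (linear_onD Pl).
by rewrite cReZ (linear_onZ subspaceT Pl).
Qed.

(** For positive extensions [Phi], the maps [x |-> Phi (Re x)] are the real
    linear maps dominated by the sublinear [p x = inf {phi e | e >= Re x}], so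
    that [sublinear_extreme] applies. *)
Theorem positive_extension : exists p : A -> W,
  [/\ forall x e, selfadjoint x -> E e -> positive (e - x) -> le (p x) (phi e),
      forall x l, selfadjoint x ->
        (forall e, E e -> positive (e - x) -> le l (phi e)) -> le l (p x),
      forall Phi, linear_on [set: A] Phi ->
        (forall x, selfadjoint x -> le (Phi x) (p x)) -> positive_extensions Phi &
      forall x, selfadjoint x -> exists2 Phi, Ext positive_extensions Phi &
        Phi x = p x].
Proof.
have phi0 := linear_on0 sE' phil.
pose S x : set W := [set phi e | e in [set e | E e /\ positive (e - cRe x)]].
have /boolp.choice[p pP] x : exists m, (forall w, S x w -> le m w) /\
    (forall l, (forall w, S x w -> le l w) -> le l m).
  apply: (ole_inf leW).
    exists (phi (cnorm (cRe x))%:C%:A); exists (cnorm (cRe x))%:C%:A => //.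
    by split; [exact: operator_system_R | apply: positive_norm; exact: cRe_sa].
  exists (phi (- (cnorm (cRe x))%:C%:A)) => _ [e [Ee ex] <-].
  have EN := subspaceN sE' (operator_system_R sE (cnorm (cRe x))).
  apply: linear_on_le => //; rewrite opprK -(subrK (cRe x) e) -addrA.
  apply: positiveD => //; rewrite addrC; apply: positive_normN; exact: cRe_sa.
have ps : sublinear (le := le) p.
  apply: (sublinearI leW) => [x y||t x t0].
  - apply: (ole_inf2 leW (pP x).2 (pP y).2) => _ _ [e [Ee ex] <-] [e' [Ee' e'y] <-].
    rewrite -(linear_onD phil) //; apply: (pP _).1; exists (e + e') => //.
    split; first exact: (subspaceD sE').
    by rewrite cReD opprD addrACA; exact: positiveD.
  - apply: (ole_anti leW).
      apply: (pP _).1; exists 0 => //; split; first exact: sE'.1.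
      by rewrite cRe_id ?subr0; [exact: positive0 | exact: sa0].
    apply: (pP _).2 => _ [e [Ee ex] <-]; apply: phi_ge0 => //.
    by move: ex; rewrite cRe_id ?subr0 //; exact: sa0.
  - apply: (pP _).2 => _ [e [Ee ex] <-].
    have eE : e = t%:C *: ((t^-1)%:C *: e).
      by rewrite scalerA -rmorphM mulfV ?gt_eqF // scale1r.
    have Ete := subspaceZ sE' (t^-1)%:C Ee.
    rewrite eE (linear_onZ sE' phil) //; apply: (oleZ leW (ltW t0)).
    apply: (pP _).1; exists ((t^-1)%:C *: e) => //; split=> //.
    by apply: (positiveZr t0); rewrite scalerBr -eE -cReZ.
have p_le x e : selfadjoint x -> E e -> positive (e - x) -> le (p x) (phi e).
  by move=> xs Ee ex; apply: (pP x).1; exists e => //; rewrite /= cRe_id.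
have p_ge x l : selfadjoint x ->
    (forall e, E e -> positive (e - x) -> le l (phi e)) -> le l (p x).
  move=> xs H; apply: (pP x).2 => _ [e [Ee ex] <-]; apply: H => //.
  by rewrite cRe_id in ex.
have p_pe Phi : linear_on [set: A] Phi ->
    (forall x, selfadjoint x -> le (Phi x) (p x)) -> positive_extensions Phi.
  move=> Pl Pp.
  have PN x : Phi (- x) = - Phi x by exact: (linear_onN subspaceT Pl).
  split=> // [x xp|].
    have xs := saN (positive_sa xp).
    have := le_trans (Pp _ xs) (p_le _ 0 xs sE'.1 _); rewrite sub0r opprK.
    by move=> /(_ xp)/(oleN leW); rewrite PN opprK phi0 oppr0.
  have PlE : linear_on E Phi by move=> a x y _ _; exact: Pl.
  apply: (linear_on_eq_sa sE) => // x Ex xs; apply: (ole_anti leW).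
    by apply: le_trans (Pp _ xs) _; apply: p_le; rewrite // subrr; exact: positive0.
  have Nx := saN xs; have ENx := subspaceN sE' Ex.
  have := le_trans (Pp _ Nx) (p_le _ _ Nx ENx _); rewrite subrr => /(_ positive0).
  by move=> /(oleN leW); rewrite PN (linear_onN sE' phil) // !opprK.
have pe_p Phi : positive_extensions Phi -> dominates (le := le) p (fun x => Phi (cRe x)).
  move=> [Pl Pp PE] x; apply: (pP x).2 => _ [e [Ee ex] <-]; rewrite -PE //.
  have := Pp _ ex; rewrite (linear_onB subspaceT Pl) //.
  by rewrite (ole_subr leW) add0r.
exists p; split=> // x xs.
have [f [fl pf fx fext]] := sublinear_extreme leW x ps.
have f_im h : selfadjoint h -> f ('i *: h) = 0.
  move=> hs.
  have ih0 u : le (f (u%:C *: ('i *: h))) 0.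
    apply: le_trans (pf _) _; rewrite -phi0; apply: (pP _).1; exists 0 => //.
    split; first exact: sE'.1.
    by rewrite cReZ cRe_imul cIm_sa0 // oppr0 scaler0 subr0; exact: positive0.
  apply: (ole_anti leW); first by have := ih0 1; rewrite scale1r.
  have := ih0 (-1); rewrite rmorphN scaleN1r (real_linearN _ fl).
  by move/(oleN leW); rewrite opprK oppr0.
have f_Re y : f (cRe y) = f y.
  by rewrite [in RHS](cReIm y) fl.1 f_im ?addr0 //; exact: cIm_sa.
have f0 : f 0 = 0 by have := fl.2 0 0; rewrite !scale0r.
pose Phi y := f (cRe y) + 'i *: f (cIm y).
have Phi_sa y : selfadjoint y -> Phi y = f y.
  by move=> ys; rewrite /Phi cRe_id // cIm_sa0 // f0 scaler0 addr0.
have PhiE : positive_extensions Phi.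
  by apply: p_pe => [|y ys]; [exact: real_linear_complexify | rewrite Phi_sa].
exists Phi; last by rewrite Phi_sa.
split=> // Phi1 Phi2 t P1 P2 t01 PhiC.
have [|f1 f2] := fext _ _ t (real_linear_Re (let: And3 a _ _ := P1 in a))
  (real_linear_Re (let: And3 a _ _ := P2 in a)) (pe_p _ P1) (pe_p _ P2) t01.
  move=> y; rewrite -f_Re -(Phi_sa _ (cRe_sa y)) PhiC //.
have [l0 _ _] := PhiE; have [l1 _ _] := P1; have [l2 _ _] := P2.
split; apply/funext => y;
  apply: (linear_on_eq_sa (operator_systemT A)) => // z _ zs; rewrite Phi_sa //.
- by rewrite -f1 cRe_id.
- by rewrite -f2 cRe_id.
Qed.

End PositiveExtension.

(** * Bounded complex functions *)

(* The real and imaginary parts with values in [R] rather than in [R[i]]. *)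
Local Notation Re := complex.Re.
Local Notation Im := complex.Im.

Section ComplexNumbers.
Context {R : realType}.
Implicit Types (x y z : R[i]) (t : R).

Lemma normc_ge0 z : 0 <= Normc.normc z.
Proof. by case: z => a b; exact: sqrtr_ge0. Qed.

Lemma normc_leD x y : Normc.normc (x + y) <= Normc.normc x + Normc.normc y.
Proof. exact: le_normcD. Qed.

Lemma normc_opp x : Normc.normc (- x) = Normc.normc x.
Proof. exact: normcN. Qed.

Lemma normc_conj z : Normc.normc (conjc z) = Normc.normc z.
Proof. by case: z => a b; rewrite /= sqrrN. Qed.

Lemma conjc_mul_normc z : conjc z * z = (Normc.normc z ^+ 2)%:C.
Proof.
case: z => a b; rewrite /= sqr_sqrtr ?addr_ge0 ?sqr_ge0 //.
by apply/eqP; rewrite eq_complex /= !mulNr opprK !expr2 (mulrC b a) subrr !eqxx.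
Qed.

Lemma normc_ge_absRe z : `|Re z| <= Normc.normc z.
Proof. by case: z => a b; rewrite /= -sqrtr_sqr ler_wsqrtr // lerDl sqr_ge0. Qed.

Lemma normc_ge_absIm z : `|Im z| <= Normc.normc z.
Proof. by case: z => a b; rewrite /= -sqrtr_sqr ler_wsqrtr // lerDr sqr_ge0. Qed.

Lemma normc_le_abs z : Normc.normc z <= `|Re z| + `|Im z|.
Proof.
case: z => a b /=; rewrite -[leRHS]ger0_norm ?addr_ge0 // -sqrtr_sqr ler_wsqrtr //.
rewrite sqrrD !real_normK ?num_real // addrAC lerDl.
by rewrite mulrn_wge0 // mulr_ge0.
Qed.

Lemma complex_ge0P z : 0 <= z -> z = (Re z)%:C /\ 0 <= Re z.
Proof. by case: z => a b; rewrite lecE /= => /andP[/eqP -> ->]. Qed.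

Definition complex_le (x y : R[i]^o) : Prop := x <= y.

Lemma complex_order_complete : complete_order complex_le.
Proof.
rewrite /complex_le.
split => [x|x y xy yx|y x z|z x y|t x y t0 xy|S [s0 Ss0] [l lS]].
- exact: lexx.
- by apply: le_anti; rewrite xy yx.
- exact: le_trans.
- by rewrite lerD2r.
- by apply: ler_wpM2l => //; rewrite ler0c.
pose T : set R := [set Re s | s in S].
have Ims s : S s -> Im s = Im l by move=> /lS; rewrite lecE => /andP[/eqP].
have T0 : has_inf T.
  split; first by exists (Re s0), s0.
  by exists (Re l) => _ [s Ss <-]; have := lS _ Ss; rewrite lecE => /andP[].
exists (inf T +i* Im l); split=> [s Ss|l' l'S].
  rewrite lecE /= Ims // eqxx /=; apply: ge_inf; first by case: T0.
  by exists s.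
have := l'S _ Ss0; rewrite !lecE /= (Ims _ Ss0) => /andP[-> _] /=.
apply: lb_le_inf; first by case: T0.
by move=> _ [s Ss <-]; have := l'S _ Ss; rewrite lecE => /andP[].
Qed.

Lemma real_cauchy (u : nat -> R) :
  (forall e, 0 < e -> exists N, forall m n, (N <= m)%N -> (N <= n)%N ->
     `|u m - u n| < e) ->
  exists l, forall e, 0 < e -> exists N, forall n, (N <= n)%N -> `|u n - l| < e.
Proof.
move=> uC; pose S : set R := [set a | exists N, forall n, (N <= n)%N -> a <= u n].
have SE e : 0 < e -> exists N, [/\ forall n, (N <= n)%N -> `|u n - u N| < e,
    S (u N - e) & ubound S (u N + e)].
  move=> /uC[N hN]; exists N; split=> [n Nn||].
  - exact: hN.
  - exists N => n Nn; have := hN _ _ Nn (leqnn N).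
    by rewrite ltr_norml => /andP[]; lra.
  - move=> a [M hM]; have := hM _ (leq_maxl M N).
    have := hN _ _ (leq_maxr M N) (leqnn N).
    by rewrite ltr_norml => /andP[]; lra.
have [N1 [_ S1 U1]] := SE _ ltr01.
have hS : has_sup S by split; eexists; [exact: S1 | exact: U1].
exists (sup S) => e e0; have e20 : 0 < e / 2 by lra.
have [N [hN SN UN]] := SE _ e20; exists N => n /hN.
have h1 := ub_le_sup hS.2 SN.
have h2 : sup S <= u N + e / 2 by apply: ge_sup => //; exact: hS.1.
by rewrite !ltr_norml => /andP[]; lra.
Qed.

Lemma complex_cauchy (u : nat -> R[i]) :
  (forall e : R, 0 < e -> exists N, forall m n, (N <= m)%N -> (N <= n)%N ->
     Normc.normc (u m - u n) < e) ->
  exists l, forall e : R, 0 < e -> exists N, forall n, (N <= n)%N ->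
    Normc.normc (u n - l) < e.
Proof.
move=> uC.
have ReB x y : Re (x - y) = Re x - Re y by case: x y => [? ?] [? ?].
have ImB x y : Im (x - y) = Im x - Im y by case: x y => [? ?] [? ?].
have [|a ha] := @real_cauchy (fun n => Re (u n)).
  move=> e /uC[N hN]; exists N => m n Nm Nn; apply: le_lt_trans (hN m n Nm Nn).
  by rewrite -ReB normc_ge_absRe.
have [|b hb] := @real_cauchy (fun n => Im (u n)).
  move=> e /uC[N hN]; exists N => m n Nm Nn; apply: le_lt_trans (hN m n Nm Nn).
  by rewrite -ImB normc_ge_absIm.
exists (a +i* b) => e e0; have e20 : 0 < e / 2 by lra.
have [N hN] := ha _ e20; have [M hM] := hb _ e20.
exists (maxn N M) => n; rewrite geq_max => /andP[/hN h1 /hM h2].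
by apply: le_lt_trans (normc_le_abs _) _; rewrite ReB ImB /=; lra.
Qed.

End ComplexNumbers.

Section BoundedFunctions.
Context {R : realType} {X : Type}.

(** The point [x0] ensures that [1] differs from [0], an axiom of the ring
    structure. *)
Definition bounded_fun (x0 : X) :=
  {f : X -> R[i] | exists M : R, forall x, Normc.normc (f x) <= M}.

Context {x0 : X}.
Local Notation L := (bounded_fun x0).
Implicit Types f g h : L.

HB.instance Definition _ := gen_eqMixin L.
HB.instance Definition _ := gen_choiceMixin L.

Lemma bounded_fun_ext f g : (forall x, sval f x = sval g x) -> f = g.
Proof.
case: f g => [f Hf] [g Hg] /= /funext fg; case: _ / fg Hg => Hg.
by congr exist; exact: Prop_irrelevance.
Qed.

Fact bf_const_subproof (c : R[i]) :
  exists M : R, forall x : X, Normc.normc ((fun=> c) x) <= M.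
Proof. by exists (Normc.normc c). Qed.

Fact bf_add_subproof f g :
  exists M : R, forall x, Normc.normc (sval f x + sval g x) <= M.
Proof.
case: f g => [f [M fM]] [g [N gN]]; exists (M + N) => x /=.
by rewrite (le_trans (normc_leD _ _)) // lerD.
Qed.

Fact bf_mul_subproof f g :
  exists M : R, forall x, Normc.normc (sval f x * sval g x) <= M.
Proof.
case: f g => [f [M fM]] [g [N gN]]; exists (M * N) => x /=.
by rewrite Normc.normcM ler_pM ?normc_ge0.
Qed.

Fact bf_conj_subproof f :
  exists M : R, forall x, Normc.normc (conjc (sval f x)) <= M.
Proof. by case: f => [f [M fM]]; exists M => x /=; rewrite normc_conj. Qed.

Definition bf_const c : L := exist _ _ (bf_const_subproof c).
Definition bf_add f g : L := exist _ _ (bf_add_subproof f g).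
Definition bf_mul f g : L := exist _ _ (bf_mul_subproof f g).
Definition bf_star f : L := exist _ _ (bf_conj_subproof f).

Fact bf_addA : associative bf_add.
Proof. by move=> f g h; apply: bounded_fun_ext => x /=; rewrite addrA. Qed.
Fact bf_addC : commutative bf_add.
Proof. by move=> f g; apply: bounded_fun_ext => x /=; rewrite addrC. Qed.
Fact bf_add0 : left_id (bf_const 0) bf_add.
Proof. by move=> f; apply: bounded_fun_ext => x /=; rewrite add0r. Qed.
Fact bf_addN : left_inverse (bf_const 0) (bf_mul (bf_const (-1))) bf_add.
Proof. by move=> f; apply: bounded_fun_ext => x /=; rewrite mulN1r addNr. Qed.
HB.instance Definition _ :=
  GRing.isZmodule.Build L bf_addA bf_addC bf_add0 bf_addN.

Fact bf_mulA : associative bf_mul.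
Proof. by move=> f g h; apply: bounded_fun_ext => x /=; rewrite mulrA. Qed.
Fact bf_mulC : commutative bf_mul.
Proof. by move=> f g; apply: bounded_fun_ext => x /=; rewrite mulrC. Qed.
Fact bf_mul1 : left_id (bf_const 1) bf_mul.
Proof. by move=> f; apply: bounded_fun_ext => x /=; rewrite mul1r. Qed.
Fact bf_mulr1 : right_id (bf_const 1) bf_mul.
Proof. by move=> f; rewrite bf_mulC bf_mul1. Qed.
Fact bf_mulDl : left_distributive bf_mul +%R.
Proof. by move=> f g h; apply: bounded_fun_ext => x /=; rewrite mulrDl. Qed.
Fact bf_mulDr : right_distributive bf_mul +%R.
Proof. by move=> f g h; apply: bounded_fun_ext => x /=; rewrite mulrDr. Qed.
Fact bf_one_neq0 : bf_const 1 != 0 :> L.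
Proof.
by apply/eqP => /(congr1 (fun f : L => sval f x0)) /= /eqP; rewrite oner_eq0.
Qed.
HB.instance Definition _ := GRing.Zmodule_isNzRing.Build L
  bf_mulA bf_mul1 bf_mulr1 bf_mulDl bf_mulDr bf_one_neq0.

Definition bf_scale c f : L := bf_mul (bf_const c) f.
Fact bf_scaleA a b f : bf_scale a (bf_scale b f) = bf_scale (a * b) f.
Proof. by apply: bounded_fun_ext => x /=; rewrite mulrA. Qed.
Fact bf_scale1 : left_id 1 bf_scale.
Proof. by move=> f; apply: bounded_fun_ext => x /=; rewrite mul1r. Qed.
Fact bf_scaleDr : right_distributive bf_scale +%R.
Proof. by move=> c f g; apply: bounded_fun_ext => x /=; rewrite mulrDr. Qed.
Fact bf_scaleDl f : {morph bf_scale^~ f : a b / a + b}.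
Proof. by move=> a b; apply: bounded_fun_ext => x /=; rewrite mulrDl. Qed.
HB.instance Definition _ := GRing.Zmodule_isLmodule.Build R[i] L
  bf_scaleA bf_scale1 bf_scaleDr bf_scaleDl.

Fact bf_scaleAl (a : R[i]) f g : a *: (f * g) = (a *: f) * g.
Proof. by apply: bounded_fun_ext => x /=; rewrite mulrA. Qed.
HB.instance Definition _ := GRing.Lmodule_isLalgebra.Build R[i] L bf_scaleAl.
Fact bf_scaleAr (a : R[i]) f g : a *: (f * g) = f * (a *: g).
Proof. by apply: bounded_fun_ext => x /=; rewrite mulrCA. Qed.
HB.instance Definition _ := GRing.Lalgebra_isAlgebra.Build R[i] L bf_scaleAr.

Definition bf_norm f : R := sup (range (fun x => Normc.normc (sval f x))).

Lemma bf_norm_ge f x : Normc.normc (sval f x) <= bf_norm f.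
Proof.
apply: ub_le_sup; last by exists x.
by case: f => [f [M fM]]; exists M => _ [y _ <-]; exact: fM.
Qed.

Lemma bf_norm_le f (t : R) : (forall x, Normc.normc (sval f x) <= t) -> bf_norm f <= t.
Proof.
move=> ft; apply: ge_sup; first by exists (Normc.normc (sval f x0)), x0.
by move=> _ [x _ <-].
Qed.

Fact bf_norm_ge0 f : 0 <= bf_norm f.
Proof. exact: le_trans (normc_ge0 _) (bf_norm_ge f x0). Qed.
Fact bf_starK : involutive bf_star.
Proof. by move=> f; apply: bounded_fun_ext => x /=; rewrite conjcK. Qed.
Fact bf_starD : {morph bf_star : f g / f + g}.
Proof. by move=> f g; apply: bounded_fun_ext => x /=; rewrite rmorphD. Qed.
Fact bf_starZ (a : R[i]) f : bf_star (a *: f) = conjc a *: bf_star f.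
Proof. by apply: bounded_fun_ext => x /=; rewrite rmorphM. Qed.
Fact bf_starM f g : bf_star (f * g) = bf_star g * bf_star f.
Proof. by apply: bounded_fun_ext => x /=; rewrite rmorphM mulrC. Qed.
Fact bf_norm0_eq0 f : bf_norm f = 0 -> f = 0.
Proof.
move=> f0; apply: bounded_fun_ext => x /=; apply: Normc.eq0_normc.
by apply/eqP; rewrite eq_le normc_ge0 andbT -f0 bf_norm_ge.
Qed.
Fact bf_normD f g : bf_norm (f + g) <= bf_norm f + bf_norm g.
Proof.
apply: bf_norm_le => x; apply: (le_trans (normc_leD _ _)).
by apply: lerD; exact: bf_norm_ge.
Qed.
Fact bf_normM f g : bf_norm (f * g) <= bf_norm f * bf_norm g.
Proof.
apply: bf_norm_le => x; rewrite [sval _ _]/= Normc.normcM.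
by apply: ler_pM; rewrite ?normc_ge0 // bf_norm_ge.
Qed.
Fact bf_normZ (a : R[i]) f : bf_norm (a *: f) = Normc.normc a * bf_norm f.
Proof.
apply: le_anti; apply/andP; split.
  apply: bf_norm_le => x; rewrite [sval _ _]/= Normc.normcM.
  by rewrite ler_wpM2l ?normc_ge0 // bf_norm_ge.
have [->|a0] := eqVneq a 0; first by rewrite Normc.normc0 mul0r bf_norm_ge0.
have na : 0 < Normc.normc a.
  by rewrite lt_def normc_ge0 andbT; apply: contra a0 => /eqP/Normc.eq0_normc ->.
rewrite mulrC -ler_pdivlMr //; apply: bf_norm_le => x; rewrite ler_pdivlMr //.
by rewrite mulrC -Normc.normcM; exact: (bf_norm_ge (a *: f) x).
Qed.
Fact bf_norm_star_mul f : bf_norm (bf_star f * f) = bf_norm f ^+ 2.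
Proof.
have E x : Normc.normc (sval (bf_star f * f) x) = Normc.normc (sval f x) ^+ 2.
  by rewrite [sval _ _]/= Normc.normcM normc_conj expr2.
apply: le_anti; apply/andP; split.
  apply: bf_norm_le => x; rewrite E ler_sqr ?nnegrE ?normc_ge0 ?bf_norm_ge0 //.
  exact: bf_norm_ge.
rewrite -[leRHS]sqr_sqrtr ?bf_norm_ge0 // ler_sqr ?nnegrE ?bf_norm_ge0 ?sqrtr_ge0 //.
apply: bf_norm_le => x; rewrite -[leLHS]ger0_norm ?normc_ge0 // -sqrtr_sqr.
by rewrite ler_wsqrtr // -E bf_norm_ge.
Qed.
Fact bf_complete (u : nat -> L) :
  (forall e : R, 0 < e -> exists N, forall m n,
       (N <= m)%N -> (N <= n)%N -> bf_norm (u m - u n) < e) ->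
    exists l, forall e : R, 0 < e -> exists N, forall n,
      (N <= n)%N -> bf_norm (u n - l) < e.
Proof.
move=> uC.
have svB f g x : sval (f - g) x = sval f x - sval g x by rewrite /= mulN1r.
have /boolp.choice[l hl] x : exists l, forall e : R, 0 < e -> exists N, forall n,
    (N <= n)%N -> Normc.normc (sval (u n) x - l) < e.
  apply: complex_cauchy => e /uC[N hN]; exists N => m n Nm Nn.
  by apply: le_lt_trans (hN m n Nm Nn); rewrite -svB bf_norm_ge.
have ul (e : R) : 0 < e -> exists N, forall n, (N <= n)%N ->
    forall x, Normc.normc (sval (u n) x - l x) <= e.
  move=> e0; have e20 : 0 < e / 2 by lra.
  have [N hN] := uC _ e20; exists N => n Nn x.
  have [M hM] := hl x _ e20; have NM := leq_maxl N M.
  have := hM _ (leq_maxr N M); have := hN _ _ Nn NM.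
  have := bf_norm_ge (u n - u (maxn N M)) x; rewrite svB.
  have := normc_leD (sval (u n) x - sval (u (maxn N M)) x)
    (sval (u (maxn N M)) x - l x); rewrite subrKA.
  by lra.
have lb : exists M : R, forall x, Normc.normc (l x) <= M.
  have [N hN] := ul _ ltr01; exists (bf_norm (u N) + 1) => x.
  have := normc_leD (sval (u N) x) (l x - sval (u N) x); rewrite addrC subrK.
  have := hN _ (leqnn N) x; rewrite -normc_opp opprB.
  by have := bf_norm_ge (u N) x; lra.
exists (exist _ l lb) => e e0; have e20 : 0 < e / 2 by lra.
have [N hN] := ul _ e20; exists N => n Nn.
apply: (@le_lt_trans _ _ (e / 2)); last by lra.
by apply: bf_norm_le => x; rewrite svB; exact: hN.
Qed.

HB.instance Definition _ := Algebra_isCStar.Build R L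
  bf_starK bf_starD bf_starZ bf_starM bf_norm0_eq0 bf_normD bf_normZ bf_normM
  bf_norm_star_mul bf_complete.

Lemma bf_subE f g x : sval (f - g) x = sval f x - sval g x.
Proof. by rewrite /= mulN1r. Qed.

Lemma bf_positiveP f : positive f <-> forall x, 0 <= sval f x.
Proof.
split=> [[g ->] x|f0].
  by rewrite [sval _ _]/= mulrC mulcJ_ge0.
have gb : exists M : R, forall x,
    Normc.normc (Num.sqrt (Re (sval f x)))%:C <= M.
  exists (Num.sqrt (bf_norm f)) => x; rewrite normcR ger0_norm ?sqrtr_ge0 //.
  rewrite ler_wsqrtr // (le_trans (ler_norm _)) // (le_trans (normc_ge_absRe _)) //.
  exact: bf_norm_ge.
exists (exist _ (fun x => (Num.sqrt (Re (sval f x)))%:C) gb : L).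
apply: bounded_fun_ext => x.
have [fE fx] := complex_ge0P (f0 x); rewrite [LHS]fE.
set s := Num.sqrt (Re (sval f x)).
transitivity (conjc s%:C * s%:C); last by [].
by rewrite conjc_real -rmorphM -expr2 sqr_sqrtr.
Qed.

End BoundedFunctions.

(** * Matrices over a C*-algebra *)

Section HilbertModule.
Context {R : realType} {A : cstarAlgType R}.

Lemma mxstarE m n (X : 'M[A]_(m, n)) i j : mxstar X i j = star (X j i).
Proof. by rewrite !mxE. Qed.

Lemma mxstarK m n (X : 'M[A]_(m, n)) : mxstar (mxstar X) = X.
Proof. by apply/matrixP => i j; rewrite !mxstarE starK. Qed.

Lemma mxstarD m n (X Y : 'M[A]_(m, n)) : mxstar (X + Y) = mxstar X + mxstar Y.
Proof. by apply/matrixP => i j; rewrite mxstarE !mxE starD. Qed.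

Lemma mxstarB m n (X Y : 'M[A]_(m, n)) : mxstar (X - Y) = mxstar X - mxstar Y.
Proof. by apply/matrixP => i j; rewrite mxstarE !mxE starB. Qed.

Lemma mxstarM m n p (X : 'M[A]_(m, n)) (Y : 'M[A]_(n, p)) :
  mxstar (X *m Y) = mxstar Y *m mxstar X.
Proof.
apply/matrixP => i j; rewrite mxstarE !mxE star_sum; apply: eq_bigr => k _.
by rewrite starM !mxstarE.
Qed.

Variable n : nat.
Implicit Types (v w : 'cV[A]_n) (X Y : 'M[A]_n) (a : A).

Definition ip v w : A := (mxstar v *m w) 0 0.

Lemma ipE v w : ip v w = \sum_i star (v i 0) * w i 0.
Proof. by rewrite /ip mxE; apply: eq_bigr => i _; rewrite mxstarE. Qed.

Lemma ipDl v v' w : ip (v + v') w = ip v w + ip v' w.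
Proof. by rewrite /ip mxstarD mulmxDl mxE. Qed.

Lemma ipDr v w w' : ip v (w + w') = ip v w + ip v w'.
Proof. by rewrite /ip mulmxDr mxE. Qed.

Lemma ipBl v v' w : ip (v - v') w = ip v w - ip v' w.
Proof. by rewrite /ip mxstarB mulmxBl !mxE. Qed.

Lemma ipBr v w w' : ip v (w - w') = ip v w - ip v w'.
Proof. by rewrite /ip mulmxBr !mxE. Qed.

Lemma ip_star v w : star (ip v w) = ip w v.
Proof. by rewrite /ip -mxstarE mxstarM mxstarK. Qed.

Lemma ipMr v w a : ip v (w *m a%:M) = ip v w * a.
Proof. by rewrite /ip mulmxA mxE big_ord1 [_%:M _ _]mxE mulr1n. Qed.

Lemma ipMl v w a : ip (v *m a%:M) w = star a * ip v w.
Proof. by rewrite -ip_star ipMr starM ip_star. Qed.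

Lemma ip_mulmx X v w : ip (X *m v) w = ip v (mxstar X *m w).
Proof. by rewrite /ip mxstarM mulmxA. Qed.

Lemma ip_ge0 v : positive (ip v v).
Proof. by rewrite ipE; apply: positive_sum => i; exact: positive_gram. Qed.

Lemma cvnormE v : cvnorm v = Num.sqrt (cnorm (ip v v)).
Proof. by rewrite ipE. Qed.

Lemma cvnorm_ge0 v : 0 <= cvnorm v. Proof. exact: sqrtr_ge0. Qed.

Lemma cvnorm_sq v : cvnorm v ^+ 2 = cnorm (ip v v).
Proof. by rewrite cvnormE sqr_sqrtr ?cnorm_ge0. Qed.

Lemma cnorm_entry_le v i : cnorm (v i 0) <= cvnorm v.
Proof.
rewrite -ler_sqr ?nnegrE ?cnorm_ge0 ?cvnorm_ge0 // cvnorm_sq -cnorm_star_mul.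
apply: cnorm_le_positive; first exact: positive_gram.
rewrite ipE (bigD1 i) //= addrAC subrr add0r big_mkcond /=.
apply: positive_sum => k; case: ifP => _; [exact: positive_gram | exact: positive0].
Qed.

Lemma cvnorm0_eq0 v : cvnorm v = 0 -> v = 0.
Proof.
move=> v0; apply/matrixP => i j; rewrite ord1 mxE; apply: cnorm0_eq0.
by apply/eqP; rewrite eq_le cnorm_ge0 andbT -v0 cnorm_entry_le.
Qed.

Lemma ip_eq0 v : ip v v = 0 -> v = 0.
Proof.
by move=> v0; apply: cvnorm0_eq0; rewrite cvnormE v0 cnorm0 sqrtr0.
Qed.

(** The Cauchy-Schwarz inequality in the algebra, from the positivity of the
    square of [v <v, w> - s w]. *)
Lemma ip_cauchy_positive v w (s : R) : 0 < s -> cnorm (ip v v) <= s ->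
  positive (s%:C *: ip w w - star (ip v w) * ip v w).
Proof.
move=> s0 vs; set c := ip v w; pose S : A := s%:C%:A.
have SM x : S * x = s%:C *: x by rewrite -scalerAl mul1r.
have MS x : x * S = s%:C *: x by rewrite -scalerAr mulr1.
apply: (positiveZr s0).
have p1 := ip_ge0 (v *m c%:M - w *m S%:M).
have p2 : positive (star c * (S - ip v v) * c).
  apply: positive_conj; rewrite -(subrKA (cnorm (ip v v))%:C%:A).
  apply: positiveD; last exact/positive_norm/positive_sa/ip_ge0.
  by rewrite -scalerBl -rmorphB; apply: positiveR; rewrite subr_ge0.
have := positiveD p1 p2; congr positive.
rewrite ipBl !ipBr !ipMl !ipMr -/c -[ip w v]ip_star -/c (saR s) -/S.
rewrite mulrBr mulrBl !mulrA !MS !SM -!scalerAl scalerBr opprB addrAC subrKA.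
by rewrite subrr add0r.
Qed.

Lemma ip_cauchy v w : cnorm (ip v w) <= cvnorm v * cvnorm w.
Proof.
have [v0|v0] := eqVneq (cvnorm v) 0.
  by rewrite (cvnorm0_eq0 v0) ipE big1 ?cnorm0 ?mulr_ge0 ?cvnorm_ge0 // => i _;
     rewrite mxE star0 mul0r.
rewrite -ler_sqr ?nnegrE ?mulr_ge0 ?cvnorm_ge0 ?cnorm_ge0 // exprMn.
have s0 : 0 < cvnorm v ^+ 2 by rewrite exprn_gt0 // lt_def v0 cvnorm_ge0.
have := @ip_cauchy_positive v w _ s0; rewrite {1}cvnorm_sq lexx => /(_ isT).
move/(cnorm_le_positive (positive_gram _)); rewrite cnorm_star_mul.
by rewrite cnormZR ?(ltW s0) // (cvnorm_sq w).
Qed.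

Lemma cvnormD v w : cvnorm (v + w) <= cvnorm v + cvnorm w.
Proof.
rewrite -ler_sqr ?nnegrE ?addr_ge0 ?cvnorm_ge0 // cvnorm_sq ipDl !ipDr sqrrD.
have := ip_cauchy v w; have := ip_cauchy w v; rewrite !cvnorm_sq => h1 h2.
have := cnormD_le (ip v v + ip v w) (ip w v + ip w w).
have := cnormD_le (ip v v) (ip v w); have := cnormD_le (ip w v) (ip w w).
by rewrite mulr2n; lra.
Qed.

Lemma cvnormZ v (a : R[i]) : cvnorm (v *m a%:A%:M) = Normc.normc a * cvnorm v.
Proof.
rewrite !cvnormE ipMl ipMr starZ star1 -scalerAl mul1r -scalerAr mulr1 scalerA.
rewrite conjc_mul_normc cnormZR ?sqr_ge0 // sqrtrM ?sqr_ge0 // sqrtr_sqr.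
by rewrite ger0_norm ?normc_ge0.
Qed.

Lemma cvnorm0 : cvnorm (0 : 'cV[A]_n) = 0.
Proof. by rewrite cvnormE -[0]subr0 ipBl subrr cnorm0 sqrtr0. Qed.

Lemma cvnorm_le_sum v : cvnorm v <= \sum_i cnorm (v i 0).
Proof.
have S0 : 0 <= \sum_i cnorm (v i 0) by rewrite sumr_ge0 // => i _; exact: cnorm_ge0.
rewrite -ler_sqr ?nnegrE ?cvnorm_ge0 // cvnorm_sq ipE.
apply: (le_trans (cnorm_sum _ _)); rewrite expr2 mulr_suml ler_sum // => i _.
rewrite cnorm_star_mul expr2 ler_wpM2l ?cnorm_ge0 //.
by rewrite (bigD1 i) //= lerDl sumr_ge0 // => k _; exact: cnorm_ge0.
Qed.

Lemma cvnorm_mulmx_le X v :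
  cvnorm (X *m v) <= (\sum_i \sum_j cnorm (X i j)) * cvnorm v.
Proof.
apply: (le_trans (cvnorm_le_sum _)); rewrite mulr_suml ler_sum // => i _.
rewrite mxE; apply: (le_trans (cnorm_sum _ _)); rewrite mulr_suml ler_sum // => j _.
by apply: (le_trans (cnormM_le _ _)); rewrite ler_wpM2l ?cnorm_ge0 ?cnorm_entry_le.
Qed.

Lemma mxnorm_has_sup X :
  has_sup [set cvnorm (X *m v) | v in [set v | cvnorm v <= 1]].
Proof.
split; first by exists (cvnorm (X *m 0)), 0 => //; rewrite /= cvnorm0 ler01.
exists (\sum_i \sum_j cnorm (X i j)) => _ [v /= v1 <-].
apply: (le_trans (cvnorm_mulmx_le _ _)); rewrite ler_piMr //.
by rewrite sumr_ge0 // => i _; rewrite sumr_ge0 // => j _; exact: cnorm_ge0.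
Qed.

Lemma mxnorm_ge1 X v : cvnorm v <= 1 -> cvnorm (X *m v) <= mxnorm X.
Proof. by move=> v1; apply: ub_le_sup; [case: (mxnorm_has_sup X) | exists v]. Qed.

Lemma mxnorm_le X (t : R) :
  (forall v, cvnorm v <= 1 -> cvnorm (X *m v) <= t) -> mxnorm X <= t.
Proof.
move=> H; apply: ge_sup; first by case: (mxnorm_has_sup X).
by move=> _ [v /= v1 <-]; exact: H.
Qed.

Lemma mxnorm_ge0 X : 0 <= mxnorm X.
Proof.
apply: le_trans (cvnorm_ge0 (X *m 0)) (@mxnorm_ge1 _ 0 _).
by rewrite cvnorm0 ler01.
Qed.

Lemma mxnorm_ge X v : cvnorm (X *m v) <= mxnorm X * cvnorm v.
Proof.
have [v0|v0] := eqVneq (cvnorm v) 0.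
  by rewrite (cvnorm0_eq0 v0) mulmx0 cvnorm0 mulr0.
have vp : 0 < cvnorm v by rewrite lt_def v0 cvnorm_ge0.
have nv : Normc.normc ((cvnorm v)^-1)%:C = (cvnorm v)^-1.
  by rewrite normcR ger0_norm // invr_ge0 ltW.
rewrite -ler_pdivrMr // mulrC -{1}nv -cvnormZ -mulmxA; apply: mxnorm_ge1.
by rewrite cvnormZ nv mulVf.
Qed.

Lemma mxnorm_le_sum X : mxnorm X <= \sum_i \sum_j cnorm (X i j).
Proof.
apply: mxnorm_le => v v1; apply: (le_trans (cvnorm_mulmx_le _ _)).
rewrite ler_piMr //.
by rewrite sumr_ge0 // => i _; rewrite sumr_ge0 // => j _; exact: cnorm_ge0.
Qed.

Lemma mxnorm_entry X i j : cnorm (X i j) <= mxnorm X.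
Proof.
pose e : 'cV[A]_n := delta_mx j 0.
have e1 : cvnorm e <= 1.
  apply: (le_trans (cvnorm_le_sum _)); rewrite (bigD1 j) //= big1 ?addr0.
    by rewrite mxE !eqxx cnorm1.
  by move=> k /negbTE kj; rewrite mxE kj cnorm0.
apply: le_trans (mxnorm_ge1 X e1); apply: le_trans (cnorm_entry_le _ i).
by rewrite -colE mxE.
Qed.

Lemma mxnorm0_eq0 X : mxnorm X = 0 -> X = 0.
Proof.
move=> X0; apply/matrixP => i j; rewrite mxE; apply: cnorm0_eq0.
by apply/eqP; rewrite eq_le cnorm_ge0 andbT -X0 mxnorm_entry.
Qed.

Lemma mxnormD X Y : mxnorm (X + Y) <= mxnorm X + mxnorm Y.
Proof.
apply: mxnorm_le => v v1; rewrite mulmxDl; apply: (le_trans (cvnormD _ _)).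
by apply: lerD; exact: mxnorm_ge1.
Qed.

Lemma mxnormM X Y : mxnorm (X *m Y) <= mxnorm X * mxnorm Y.
Proof.
apply: mxnorm_le => v v1; rewrite -mulmxA; apply: (le_trans (mxnorm_ge _ _)).
by rewrite ler_wpM2l ?mxnorm_ge0 // mxnorm_ge1.
Qed.

Definition mxscale (a : R[i]) X : 'M[A]_n := map_mx ( *:%R a) X.

Lemma mxscaleE (a : R[i]) X i j : mxscale a X i j = a *: X i j.
Proof. by rewrite mxE. Qed.

Lemma mulmx_mxscale (a : R[i]) X v : mxscale a X *m v = X *m v *m a%:A%:M.
Proof.
apply/matrixP => i j; rewrite !ord1 [RHS]mxE big_ord1 [_%:M _ _]mxE mulr1n.
rewrite -scalerAr mulr1 !mxE scaler_sumr; apply: eq_bigr => k _.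
by rewrite mxscaleE scalerAl.
Qed.

Lemma mxnormZ (a : R[i]) X : mxnorm (mxscale a X) = Normc.normc a * mxnorm X.
Proof.
apply: le_anti; apply/andP; split.
  apply: mxnorm_le => v v1; rewrite mulmx_mxscale cvnormZ.
  by rewrite ler_wpM2l ?normc_ge0 // mxnorm_ge1.
have [->|a0] := eqVneq a 0; first by rewrite Normc.normc0 mul0r mxnorm_ge0.
have na : 0 < Normc.normc a.
  by rewrite lt_def normc_ge0 andbT; apply: contra a0 => /eqP/Normc.eq0_normc ->.
rewrite mulrC -ler_pdivlMr //; apply: mxnorm_le => v v1; rewrite ler_pdivlMr //.
by rewrite mulrC -cvnormZ -mulmx_mxscale mxnorm_ge1.
Qed.

(** The inequality [<X v, X v> = <v, X* X v>] gives with Cauchy-Schwarz that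
    [mxnorm X ^ 2] is at most [mxnorm (X* X)], hence also that the involution
    is isometric. *)
Lemma mxnorm_star_mul X : mxnorm (mxstar X *m X) = mxnorm X ^+ 2.
Proof.
have H Y : mxnorm Y ^+ 2 <= mxnorm (mxstar Y *m Y).
  rewrite -[leRHS]sqr_sqrtr ?mxnorm_ge0 // ler_sqr ?nnegrE ?sqrtr_ge0 ?mxnorm_ge0 //.
  apply: mxnorm_le => v v1; rewrite cvnormE ler_wsqrtr //.
  rewrite ip_mulmx mulmxA; apply: (le_trans (ip_cauchy _ _)).
  have := mxnorm_ge1 (mxstar Y *m Y) v1.
  have := cvnorm_ge0 v; have := cvnorm_ge0 (mxstar Y *m Y *m v); nra.
have star_le Y : mxnorm Y <= mxnorm (mxstar Y).
  have [->|Y0] := eqVneq Y 0.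
    suff -> : mxstar (0 : 'M[A]_n) = 0 by [].
    by apply/matrixP => i j; rewrite mxstarE !mxE star0.
  have Yp : 0 < mxnorm Y.
    by rewrite lt_def mxnorm_ge0 andbT; apply: contra Y0 => /eqP/mxnorm0_eq0 ->.
  by have := le_trans (H Y) (mxnormM _ _); rewrite expr2 ler_pM2r.
apply: le_anti; rewrite H andbT; apply: (le_trans (mxnormM _ _)).
by rewrite expr2 ler_wpM2r ?mxnorm_ge0 // -{2}(mxstarK X) star_le.
Qed.

Lemma mxnorm_complete (u : nat -> 'M[A]_n) :
  (forall e : R, 0 < e -> exists N, forall m k,
       (N <= m)%N -> (N <= k)%N -> mxnorm (u m - u k) < e) ->
    exists l, forall e : R, 0 < e -> exists N, forall m,
      (N <= m)%N -> mxnorm (u m - l) < e.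
Proof.
move=> uC.
have E m k i j : (u m - u k) i j = u m i j - u k i j by rewrite !mxE.
have /boolp.choice[l hl] (ij : 'I_n * 'I_n) : exists l, cconv (fun m => u m ij.1 ij.2) l.
  apply: cnorm_complete => e /uC[N hN]; exists N => m k Nm Nk.
  by apply: le_lt_trans (hN m k Nm Nk); rewrite -E mxnorm_entry.
exists (\matrix_(i, j) l (i, j)) => e e0.
pose K : R := (n * n)%:R + 1; have K0 : 0 < K by rewrite ltr_wpDl.
have eK : 0 < e / K by rewrite divr_gt0.
have /boolp.choice[N hN] (ij : 'I_n * 'I_n) := hl ij _ eK.
exists (\max_ij N ij)%N => m Nm; apply: (le_lt_trans (mxnorm_le_sum _)).
apply: (@le_lt_trans _ _ (\sum_(i < n) \sum_(j < n) e / K)).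
  apply: ler_sum => i _; apply: ler_sum => j _; rewrite !mxE; apply: ltW.
  by apply: (hN (i, j)); apply: leq_trans Nm; exact: leq_bigmax.
rewrite !sumr_const !card_ord -mulrnA -mulr_natr mulrAC ltr_pdivrMr //.
by rewrite ltr_pM2l // ltrDl.
Qed.

End HilbertModule.

Section MatrixAlgebra.
Context {R : realType} {A : cstarAlgType R} {n : nat}.

(** A synonym of the type of square matrices, which carries an action of the
    complex numbers where the type itself carries one of [A]. *)
Definition mxalg : Type := 'M[A]_n.+1.

HB.instance Definition _ := GRing.NzRing.copy mxalg 'M[A]_n.+1.
Implicit Types X Y : mxalg.

Fact mxalg_scaleA a b X : mxscale a (mxscale b X) = mxscale (a * b) X.
Proof. by apply/matrixP => i j; rewrite !mxscaleE scalerA. Qed.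
Fact mxalg_scale1 : left_id 1 (@mxscale R A n.+1).
Proof. by move=> X; apply/matrixP => i j; rewrite !mxscaleE scale1r. Qed.
Fact mxalg_scaleDr : right_distributive (@mxscale R A n.+1) +%R.
Proof. by move=> a X Y; apply/matrixP => i j; rewrite !mxE scalerDr. Qed.
Fact mxalg_scaleDl (X : 'M[A]_n.+1) : {morph (@mxscale R A n.+1)^~ X : a b / a + b}.
Proof. by move=> a b; apply/matrixP => i j; rewrite !mxE scalerDl. Qed.
HB.instance Definition _ := GRing.Zmodule_isLmodule.Build R[i] mxalg
  mxalg_scaleA mxalg_scale1 mxalg_scaleDr mxalg_scaleDl.

Fact mxalg_scaleAl (a : R[i]) X Y : a *: (X * Y) = (a *: X) * Y.
Proof.
apply/matrixP => i j; rewrite !mxE scaler_sumr; apply: eq_bigr => k _.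
by rewrite mxscaleE scalerAl.
Qed.
HB.instance Definition _ := GRing.Lmodule_isLalgebra.Build R[i] mxalg mxalg_scaleAl.
Fact mxalg_scaleAr (a : R[i]) X Y : a *: (X * Y) = X * (a *: Y).
Proof.
apply/matrixP => i j; rewrite !mxE scaler_sumr; apply: eq_bigr => k _.
by rewrite mxscaleE scalerAr.
Qed.
HB.instance Definition _ := GRing.Lalgebra_isAlgebra.Build R[i] mxalg mxalg_scaleAr.

Fact mxalg_starZ (a : R[i]) X : mxstar (a *: X) = conjc a *: (mxstar X : mxalg).
Proof. by apply/matrixP => i j; rewrite !mxE starZ. Qed.

HB.instance Definition _ := Algebra_isCStar.Build R mxalg
  (@mxstarK R A n.+1 n.+1) (@mxstarD R A n.+1 n.+1) mxalg_starZ
  (@mxstarM R A n.+1 n.+1 n.+1) (@mxnorm0_eq0 R A n.+1) (@mxnormD R A n.+1)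
  (@mxnormZ R A n.+1) (@mxnormM R A n.+1) (@mxnorm_star_mul R A n.+1)
  (@mxnorm_complete R A n.+1).

End MatrixAlgebra.
Arguments mxalg {R} A n.

(** Compressing a self-adjoint matrix [X] by [b] as in [negative_part] turns
    [<b v, X b v> >= 0] into [- <c v, c v> >= 0]. *)
Lemma mxpositive_ip (R : realType) (A : cstarAlgType R) n (X : 'M[A]_n) :
  mxstar X = X -> (forall v, positive (ip v (X *m v))) -> mxpositive X.
Proof.
case: n X => [|n] X Xs Xp; first by exists 0; rewrite [LHS]thinmx0 [RHS]thinmx0.
suff : positive (X : mxalg A n) by [].
apply/positiveP.
have [b [c [bs cs bXb]]] := negative_part (x := X : mxalg A n) Xs; apply.
suff cv (v : 'cV[A]_n.+1) : c *m v = 0.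
  apply/matrixP => i j; have /matrixP/(_ i 0) := cv (delta_mx j 0).
  by rewrite -colE !mxE.
apply: ip_eq0; apply: positive_anti (ip_ge0 _) _.
have := Xp (b *m v); rewrite !ip_mulmx (bs : mxstar b = b) (cs : mxstar c = c).
rewrite !mulmxA [b *m X *m b](_ : _ = - (c *m c)); last exact: bXb.
by rewrite mulNmx -[- (_ *m v)]sub0r ipBr /ip mulmx0 [_ 0 0]mxE sub0r.
Qed.

(** * Unital isometries and completely positive maps *)

Section UnitalIsometry.
Context {R : realType} {A B : cstarAlgType R}.
Variables (S : set A) (f : A -> B).
Hypotheses (sS : subspace S) (S1 : S 1) (fl : linear_on S f) (f1 : f 1 = 1).
Hypothesis f_contr : forall x, S x -> cnorm (f x) <= cnorm x.

Let SR (t : R) : S t%:C%:A. Proof. exact: subspaceZ. Qed.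
Let fR (t : R) : f t%:C%:A = t%:C%:A.
Proof. by rewrite (linear_onZ sS fl) // f1. Qed.

(** With [b] the imaginary part of [f x], the norm of [b + t] is at most that
    of [x + i t], which is asymptotically [t] as [t] grows; hence [b <= 0]. *)
Lemma unital_contraction_Im_le0 x : S x -> selfadjoint x ->
  positive (- cIm (f x)).
Proof.
move=> Sx xs; apply: positive_archimedean => [|e e0]; first exact/saN/cIm_sa.
pose n := cnorm x; pose t := n ^+ 2 / (2 * e).
have t0 : 0 <= t by rewrite divr_ge0 ?sqr_ge0 // mulr_ge0 // ltW.
pose y := x + 'i *: (t%:C%:A : A).
have Sy : S y by apply: subspaceD => //; apply: subspaceZ.
have yn : cnorm y <= t + e.
  have te : 0 <= t + e by rewrite addr_ge0 // ltW.
  rewrite -ler_sqr ?nnegrE ?cnorm_ge0 // -cnorm_star_mul.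
  have -> : star y * y = x * x + (t ^+ 2)%:C%:A.
    rewrite /y; have Ts := saR (A := A) t; have xT : x * t%:C%:A = t%:C%:A * x.
      by rewrite -scalerAr -scalerAl mulr1 mul1r.
    rewrite (_ : (t ^+ 2)%:C%:A = t%:C%:A * t%:C%:A); last first.
      by rewrite -scalerAr mulr1 scalerA -rmorphM expr2.
    move: (t%:C%:A : A) Ts xT => T Ts xT; rewrite starD star_imul xs Ts.
    by rewrite mulrBl !mulrDr -!scalerAl -!scalerAr xT opprD addrA addrK scale_ii opprK.
  apply: (le_trans (cnormD_le _ _)); rewrite sa_normsq // cnormR ?sqr_ge0 //.
  have : t * (2 * e) = n ^+ 2 by rewrite /t divfK // gt_eqF // mulr_gt0.
  rewrite sqrrD mulr2n -/n; have := sqr_ge0 e; lra.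
have fy : cIm (f y) = cIm (f x) + t%:C%:A.
  rewrite (linear_onD fl) //; last exact: subspaceZ.
  by rewrite (linear_onZ sS fl) // fR cImD cIm_imul cRe_id //; exact: saR.
have := positive_norm (cIm_sa (f y)); rewrite fy => p.
have : positive ((t + e)%:C%:A - (cIm (f x) + t%:C%:A)).
  rewrite -(subrKA (cnorm (cIm (f x) + t%:C%:A))%:C%:A); apply: positiveD => //.
  rewrite -scalerBl -rmorphB; apply: positiveR; rewrite subr_ge0 -fy.
  by apply: le_trans yn; apply: le_trans (cnorm_cIm_le _) _; exact: f_contr.
congr positive.
by rewrite rmorphD scalerDl opprD (AC (2*2) ((2*3)*(1*4))) /= subrr addr0.
Qed.

Lemma unital_contraction_sa x : S x -> selfadjoint x -> selfadjoint (f x).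
Proof.
move=> Sx xs; have p := unital_contraction_Im_le0 Sx xs.
have := unital_contraction_Im_le0 (subspaceN sS Sx) (saN xs).
rewrite (linear_onN sS fl) // -[in cIm (- _)]scaleN1r -(rmorphN1 (real_complex R)).
rewrite cImZ rmorphN1 scaleN1r => np.
have b0 := positive_anti p np; rewrite (cReIm (f x)).
by move/eqP: b0; rewrite oppr_eq0 => /eqP ->; rewrite scaler0 addr0; exact: cRe_sa.
Qed.

Lemma unital_contraction_positive x : S x -> positive x -> positive (f x).
Proof.
move=> Sx /positiveP[xs [t t0 ht]].
apply: (positive_near (unital_contraction_sa Sx xs) t0).
rewrite -fR -(linear_onB sS fl) //; apply: le_trans ht; apply: f_contr.
exact: subspaceB.
Qed.

End UnitalIsometry.

Lemma sa_preserving_star (R : realType) (A B : cstarAlgType R) (S : set A)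
    (f : A -> B) : operator_system S -> linear_on S f ->
  (forall x, S x -> selfadjoint x -> selfadjoint (f x)) ->
  forall x, S x -> f (star x) = star (f x).
Proof.
move=> sS fl fs x Sx; have sS' := operator_system_subspace sS.
have ER := operator_system_Re sS Sx; have EI := operator_system_Im sS Sx.
have EiI := subspaceZ sS' 'i EI.
have xE : star x = cRe x - 'i *: cIm x.
  by rewrite {1}(cReIm x) starD star_imul (cRe_sa x) (cIm_sa x).
have := linear_onB sS' fl ER EiI; rewrite -xE => ->.
rewrite (linear_on_ReIm sS fl Sx) starD star_imul (linear_onZ sS' fl 'i EI).
by rewrite (fs _ ER (cRe_sa x)) (fs _ EI (cIm_sa x)).
Qed.

Lemma positive_preserving_sa (R : realType) (A B : cstarAlgType R) (S : set A)
    (f : A -> B) : operator_system S -> linear_on S f ->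
  (forall x, S x -> positive x -> positive (f x)) ->
  forall x, S x -> selfadjoint x -> selfadjoint (f x).
Proof.
move=> sS fl fp x Sx xs; have sS' := operator_system_subspace sS.
have SR := operator_system_R sS (cnorm x).
rewrite -(subKr (cnorm x)%:C%:A x) (linear_onB sS' fl) //; last exact: subspaceB.
apply: saB; apply: positive_sa; apply: fp => //.
- by apply: positiveR; exact: cnorm_ge0.
- exact: subspaceB.
- exact: positive_norm.
Qed.

Section CompletelyPositive.
Context {R : realType} {A B : cstarAlgType R}.
Implicit Types (S : set A) (T : set B) (f : A -> B).

(** A unital complete isometry is, on each matrix algebra, a unital isometry
    between subspaces of C*-algebras. *)
Lemma unital_complete_isometry_ucp S T f : subspace S -> S 1 ->
  unital_complete_isometry S T f -> ucp S T f.
Proof.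
move=> sS S1 [[f1 fT fl] fn]; split=> // n X SX.
have f0 := linear_on0 sS fl.
case: n X SX => [|n] X SX Xp; first by exists 0; rewrite [LHS]thinmx0 [RHS]thinmx0.
pose SM : set (mxalg A n) := [set Y | forall i j, S (Y i j)].
suff : positive (map_mx f X : mxalg B n) by [].
apply: (@unital_contraction_positive _ (mxalg A n) (mxalg B n) SM (map_mx f)) => //.
- split=> [i j|a Y Z SY SZ i j]; first by rewrite mxE; exact: sS.1.
  by rewrite !mxE; apply: sS.2.
- by move=> i j; rewrite mxE; case: (i == j); rewrite ?mulr1n // mulr0n; exact: sS.1.
- by move=> a Y Z SY SZ; apply/matrixP => i j; rewrite !mxE fl.
- by apply/matrixP => i j; rewrite !mxE; case: (i == j).
- by move=> Y SY; have := fn _ Y SY => /= h; rewrite /cnorm /= h.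
Qed.

Lemma ucp_linear S T f : ucp S T f -> linear_on S f.
Proof. by case=> [[]]. Qed.

Lemma ucp_positive S T f x : ucp S T f -> S x -> positive x -> positive (f x).
Proof.
move=> [_ fcp] Sx [y xE].
have [||Z] := fcp 1%N (const_mx x).
- by move=> i j; rewrite mxE.
- by exists (const_mx y); apply/matrixP => i j; rewrite !mxE big_ord1 !mxE.
move=> /matrixP/(_ 0 0); rewrite !mxE big_ord1 !mxE => ->.
exact: positive_gram.
Qed.

Lemma ucp_sa S T f x : operator_system S -> ucp S T f -> S x -> selfadjoint x ->
  selfadjoint (f x).
Proof.
move=> sS fu; apply: (positive_preserving_sa sS (ucp_linear fu)) => y.
exact: (ucp_positive fu).
Qed.

Lemma ucp_star S T f x : operator_system S -> ucp S T f -> S x ->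
  f (star x) = star (f x).
Proof.
move=> sS fu; apply: (sa_preserving_star sS (ucp_linear fu)) => y.
exact: (ucp_sa sS fu).
Qed.

End CompletelyPositive.

Section CompleteIsometry.
Context {R : realType} {A B : cstarAlgType R}.
Implicit Types f : A -> B.

Lemma ucp_comp (C : cstarAlgType R) (g : B -> C) f :
  ucp [set: A] [set: B] f -> ucp [set: B] [set: C] g ->
  ucp [set: A] [set: C] (g \o f).
Proof.
move=> [[f1 _ fl] fcp] [[g1 _ gl] gcp]; split=> [|n X _ Xp].
  by split=> //= [|a x y _ _]; rewrite ?f1 ?g1 // fl // gl.
have -> : map_mx (g \o f) X = map_mx g (map_mx f X).
  by apply/matrixP => i j; rewrite !mxE.
by apply: gcp => //; exact: fcp.
Qed.

(** The inverse is again a unital complete isometry, and the range is an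
    operator system because positive maps preserve the involution. *)
Lemma unital_complete_isometry_inverse f :
  unital_complete_isometry [set: A] [set: B] f ->
  operator_system (range f) /\ exists g, ucp (range f) [set: A] g /\ cancel f g.
Proof.
move=> fi; have fu := unital_complete_isometry_ucp subspaceT I fi.
have [[f1 _ fl] fn] := fi.
have f_inj : injective f.
  move=> x y fxy; apply/eqP; rewrite -subr_eq0; apply/eqP.
  have := fn 1%N (const_mx (x - y)); rewrite (_ : map_mx _ _ = 0).
    rewrite -[0]/(0 : mxalg B 0) -[mxnorm 0]/(cnorm (0 : mxalg B 0)) cnorm0.
    by move=> /(_ (fun _ _ => I))/esym/mxnorm0_eq0/matrixP/(_ 0 0); rewrite !mxE.
  by apply/matrixP => i j; rewrite !mxE (linear_onB subspaceT fl) // fxy subrr.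
have sE : operator_system (range f).
  split; first by exists 1.
    by move=> a _ _ [x _ <-] [y _ <-]; exists (a *: x + y); rewrite ?fl.
  by move=> _ [x _ <-]; exists (star x) => //; rewrite (ucp_star (operator_systemT A) fu).
split=> //.
pose g y := if pselect (exists x, f x = y) is left h then projT1 (cid h) else 0.
have fK : cancel f g.
  move=> x; rewrite /g; case: pselect => [h|[]]; last by exists x.
  by apply: f_inj; rewrite (projT2 (cid h)).
exists g; split=> //; apply: unital_complete_isometry_ucp.
- exact: operator_system_subspace.
- by exists 1.
split.
  split=> //; first by rewrite -f1 fK.
  by move=> a _ _ [x _ <-] [y _ <-]; rewrite -fl // !fK.
move=> n X rX.
have {1}-> : X = map_mx f (map_mx g X).
  by apply/matrixP => i j; rewrite !mxE; have [x _ <-] := rX i j; rewrite fK.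
have -> : map_mx g (map_mx f (map_mx g X)) = map_mx g X.
  by apply/matrixP => i j; rewrite !mxE fK.
rewrite -fn //; congr mxnorm.
by apply/matrixP => i j; rewrite !mxE; have [x _ <-] := rX i j; rewrite fK.
Qed.

End CompleteIsometry.

(** Infima are computed pointwise in the algebra of bounded functions and
    carried back by the retraction. *)
Lemma bounded_retract_complete (R : realType) (I : cstarAlgType R) (X : Type)
    (x0 : X) (tau : I -> bounded_fun (R := R) x0) (rho : bounded_fun x0 -> I) :
  ucp [set: I] [set: bounded_fun x0] tau -> ucp [set: bounded_fun x0] [set: I] rho ->
  cancel tau rho -> complete_order (W := I) (@cle R I).
Proof.
move=> tu ru tauK.
have tl := ucp_linear tu; have rl := ucp_linear ru.
split => [x|x y xy yx|y x z xy yz|z x y xy|t x y t0 xy|S [s0 Ss0] [l lS]].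
- by rewrite /cle subrr; exact: positive0.
- by apply/eqP; rewrite eq_sym -subr_eq0 (positive_anti xy) // opprB.
- by rewrite /cle -(subrKA y); exact: positiveD.
- by rewrite /cle opprD addrACA subrr addr0.
- by rewrite /cle -scalerBr; exact: positiveZ.
pose f s := tau (s - l).
have f0 s : S s -> forall x, 0 <= sval (f s) x.
  by move=> Ss; apply/bf_positiveP/(ucp_positive tu) => //; exact: lS.
pose V x : set R := [set complex.Re (sval (f s) x) | s in S].
have Vb x : has_inf (V x).
  split; first by exists (complex.Re (sval (f s0) x)), s0.
  by exists 0 => _ [s Ss <-]; case: (complex_ge0P (f0 s Ss x)).
have g0 x : 0 <= inf (V x).
  apply: lb_le_inf; first by case: (Vb x).
  by move=> _ [s Ss <-]; case: (complex_ge0P (f0 s Ss x)).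
have gf s x : S s -> inf (V x) <= complex.Re (sval (f s) x).
  by move=> Ss; apply: ge_inf; [case: (Vb x) | exists s].
have gb : exists M : R, forall x, Normc.normc (inf (V x))%:C <= M.
  exists (cnorm (f s0)) => x; rewrite normcR ger0_norm //.
  apply: le_trans (gf _ x Ss0) _; apply: (le_trans (ler_norm _)).
  by apply: (le_trans (normc_ge_absRe _)); exact: bf_norm_ge.
pose g : bounded_fun x0 := exist _ (fun x => (inf (V x))%:C) gb.
exists (l + rho g); split=> [s Ss|m mS].
  have -> : cle (l + rho g) s = positive (rho (f s - g)).
    by rewrite /cle (linear_onB subspaceT rl) // /f tauK opprD addrA.
  apply: (ucp_positive ru) => //; apply/bf_positiveP => x; rewrite bf_subE.
  have [-> _] := complex_ge0P (f0 s Ss x).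
  by rewrite subr_ge0 lecR gf.
have -> : cle m (l + rho g) = positive (rho (g - tau (m - l))).
  by rewrite /cle (linear_onB subspaceT rl) // tauK opprB addrCA addrA.
apply: (ucp_positive ru) => //; apply/bf_positiveP => x; rewrite bf_subE subr_ge0.
have ms s : S s -> sval (tau (m - l)) x <= sval (f s) x.
  move=> Ss; rewrite -subr_ge0 -bf_subE /f -(linear_onB subspaceT tl) //.
  rewrite opprB addrA subrK.
  by move: x; apply/bf_positiveP/(ucp_positive tu) => //; exact: mS.
have := ms _ Ss0; have [-> _] := complex_ge0P (f0 s0 Ss0 x).
rewrite !lecE => /andP[/eqP Im0 _]; rewrite -Im0 eqxx /=.
apply: lb_le_inf; first by case: (Vb x).
by move=> _ [s Ss <-]; have := ms s Ss; rewrite lecE => /andP[].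
Qed.

(** * States and characters *)

Section States.
Context {R : realType} {B : cstarAlgType R}.
Variable f : B -> R[i]^o.
Hypotheses (fl : linear_on [set: B] f) (f1 : f 1 = 1).
Hypothesis f_ge0 : forall b, positive b -> 0 <= f b.

Let fR (t : R) : f t%:C%:A = t%:C.
Proof. by rewrite (linear_onZ subspaceT fl) // f1; exact: mulr1. Qed.

Lemma state_sa_le b : selfadjoint b -> Normc.normc (f b) <= cnorm b.
Proof.
move=> bs; have p := f_ge0 (positive_norm bs); have q := f_ge0 (positive_normN bs).
rewrite (linear_onB subspaceT fl) // fR subr_ge0 in p.
rewrite (linear_onD fl) // fR -[f b]opprK subr_ge0 in q.
move: p q; case: (f b) => u v; rewrite !lecE /= => /andP[/eqP <- ub] /andP[_ lb].
rewrite expr0n /= addr0 sqrtr_sqr ler_norml ub andbT.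
by rewrite lerNl.
Qed.

Lemma state_bounded b : Normc.normc (f b) <= cnorm (cRe b) + cnorm (cIm b).
Proof.
rewrite (linear_on_ReIm (operator_systemT B) fl) //.
apply: (le_trans (normc_leD _ _)); apply: lerD; first exact/state_sa_le/cRe_sa.
rewrite -[_ *: _]/('i * _) Normc.normcM.
have -> : Normc.normc ('i : R[i]) = 1 by rewrite /= expr0n expr1n add0r sqrtr1.
by rewrite mul1r; exact/state_sa_le/cIm_sa.
Qed.

Lemma state_star b : f (star b) = conjc (f b).
Proof.
have fs c : selfadjoint c -> conjc (f c) = f c.
  move=> cs; have := f_ge0 (positive_norm cs).
  rewrite (linear_onB subspaceT fl) // fR subr_ge0 lecE => /andP[/eqP].
  by case: (f c) => u v /= <- _; rewrite oppr0.
have fi c : f ('i *: c) = 'i * f c by exact: (linear_onZ subspaceT fl).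
rewrite {1}(cReIm b) starD star_imul (cRe_sa b) (cIm_sa b).
rewrite (linear_onB subspaceT fl) // fi.
rewrite [in RHS](cReIm b) (linear_onD fl) // fi.
move: (f (cRe b)) (f (cIm b)) (fs _ (cRe_sa b)) (fs _ (cIm_sa b)).
move=> [u u'] [v v'] [uE] [vE]; apply/eqP; rewrite eq_complex /=.
by rewrite !(mul0r, mul1r, addr0, sub0r, add0r) opprD opprK uE vE !eqxx.
Qed.

End States.

Section BoundedFunctionMaps.
Context {R : realType} {X : Type} {x0 : X} {B : cstarAlgType R}.
Local Notation L := (bounded_fun (R := R) x0).

Lemma bf_sumE (I : Type) (r : seq I) (F : I -> L) x :
  sval (\sum_(i <- r) F i) x = \sum_(i <- r) sval (F i) x.
Proof. by elim: r => [|i r IH]; rewrite ?big_nil // !big_cons -IH. Qed.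

(** At each point such a map is a state [g], and the matrix of the [g (X i j)] is
    positive because its value on a column [w] of scalars is [g (w* X w)]. *)
Lemma positive_bf_ucp (f : B -> L) : linear_on [set: B] f -> f 1 = 1 ->
  (forall b, positive b -> positive (f b)) -> ucp [set: B] [set: L] f.
Proof.
move=> fl f1 fp; split=> // n X' _ [Y XE].
have fstar b : f (star b) = star (f b).
  apply: (sa_preserving_star (operator_systemT B) fl) => // c Sc.
  apply: (positive_preserving_sa (operator_systemT B) fl) => // d _; exact: fp.
apply: mxpositive_ip.
  apply/matrixP => i j; rewrite mxstarE !mxE -fstar; congr f.
  by rewrite -mxstarE XE mxstarM mxstarK.
move=> v; apply/bf_positiveP => x.
pose w : 'cV[B]_n := \col_i (sval (v i 0) x)%:A.
suff -> : sval (ip v (map_mx f X' *m v)) x = sval (f (ip w (X' *m w))) x.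
  have -> : ip w (X' *m w) = ip (Y *m w) (Y *m w) by rewrite ip_mulmx mulmxA -XE.
  by have /bf_positiveP := fp _ (ip_ge0 (Y *m w)); apply.
have fsum (I : Type) (r : seq I) (F : I -> B) :
    f (\sum_(i <- r) F i) = \sum_(i <- r) f (F i).
  apply: big_morph; first by move=> a b; rewrite (linear_onD fl).
  exact: (linear_on0 subspaceT fl).
rewrite !ipE fsum !bf_sumE; apply: eq_bigr => i _.
rewrite [w i 0]mxE starZ star1 -scalerAl mul1r (linear_onZ subspaceT fl) //.
rewrite -[LHS]/(conjc (sval (v i 0) x) * sval ((map_mx f X' *m v) i 0) x).
rewrite -[RHS]/(conjc (sval (v i 0) x) * sval (f ((X' *m w) i 0)) x).
congr (_ * _); rewrite !mxE fsum !bf_sumE; apply: eq_bigr => k _.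
rewrite !mxE -scalerAr mulr1 (linear_onZ subspaceT fl) //.
by rewrite -[LHS]/(sval (f (X' i k)) x * sval (v k 0) x) mulrC.
Qed.

End BoundedFunctionMaps.

(** A ucp map into bounded functions is a family of states, each of which
    extends from an operator system to the whole algebra. *)
Lemma bounded_fun_injective (R : realType) (X : Type) (x0 : X) :
  injective_system [set: bounded_fun (R := R) x0].
Proof.
move=> C E F sE sF EF f fu; have fl := ucp_linear fu; have [[f1 _ _] _] := fu.
pose phi x (b : C) : R[i]^o := sval (f b) x.
have /boolp.choice[Phi PhiP] x : exists Phi : C -> R[i]^o,
    positive_extensions (le := @complex_le R) E (phi x) Phi.
  have [||p [_ _ _ /(_ 0 (sa0))]] := @positive_extension _ C _ _
     (@complex_order_complete R) E (phi x) sE.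
  - by move=> a b c Eb Ec; rewrite /phi fl.
  - move=> b Eb bp; rewrite /phi.
    by move: x; apply/bf_positiveP; exact: (ucp_positive fu).
  by case=> Phi [PhiE _] _; exists Phi.
have Phil x : linear_on [set: C] (Phi x) by have [] := PhiP x.
have Phip x b : positive b -> 0 <= Phi x b by have [_ h _] := PhiP x; exact: h.
have PhiE x b : E b -> Phi x b = sval (f b) x by have [_ _ h] := PhiP x; exact: h.
have Phi1 x : Phi x 1 = 1 by rewrite PhiE ?f1; case: sE.
have gb b : exists M : R, forall x, Normc.normc (Phi x b) <= M.
  exists (cnorm (cRe b) + cnorm (cIm b)) => x.
  by apply: state_bounded => //; exact: Phip.
pose g b : bounded_fun x0 := exist _ (fun x => Phi x b) (gb b).
have gu : ucp [set: C] [set: bounded_fun x0] g.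
  apply: positive_bf_ucp => [a b c _ _||b bp].
  - by apply: bounded_fun_ext => x /=; rewrite Phil.
  - by apply: bounded_fun_ext => x /=; rewrite Phi1.
  - by apply/bf_positiveP => x /=; exact: Phip.
exists g => [|b Eb]; last by apply: bounded_fun_ext => x /=; rewrite PhiE.
have [[g1 _ gl] gcp] := gu; split=> [|n X' _]; last exact: gcp.
by split=> // a b c _ _; exact: gl.
Qed.

Section Characters.
Context {R : realType} {D : cstarAlgType R}.
Hypothesis DC : forall x y : D, x * y = y * x.

Definition scalars : set D := range (fun c : R[i] => c%:A).

Lemma scalars_operator_system : operator_system scalars.
Proof.
split; first by exists 1; rewrite ?scale1r.
  by move=> a _ _ [c _ <-] [d _ <-]; exists (a * c + d); rewrite // scalerDl scalerA.
by move=> _ [c _ <-]; exists (conjc c); rewrite // starZ star1.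
Qed.

(** The functional [c 1 |-> c], of which the states are the positive
    extensions. *)
Definition scalar_value (x : D) : R[i]^o :=
  if pselect (exists c : R[i], x = c%:A) is left h then projT1 (cid h) else 0.

Lemma scalar_valueE (c : R[i]) : scalar_value c%:A = c.
Proof.
rewrite /scalar_value; case: pselect => [h|[]]; last by exists c.
case: (cid h) => d /= /eqP; rewrite -subr_eq0 -scalerBl => /eqP cd.
have := cnormZ (c - d) (1 : D); rewrite cd cnorm0 cnorm1 mulr1.
by move=> /esym/Normc.eq0_normc/eqP; rewrite subr_eq0 => /eqP ->.
Qed.

Lemma scalar_value_linear : linear_on scalars scalar_value.
Proof.
move=> a _ _ [c _ <-] [d _ <-].
by rewrite scalerA -scalerDl !scalar_valueE.
Qed.

Lemma scalar_positive (c : R[i]) : positive (c%:A : D) -> 0 <= c.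
Proof.
move=> cp; have := positive_sa cp; rewrite /selfadjoint /= starZ star1.
move/(congr1 scalar_value); rewrite !scalar_valueE.
case: c cp => u v cp [/eqP].
rewrite -subr_eq0 -opprD oppr_eq0 -mulr2n mulrn_eq0 /= => /eqP v0.
by move: cp; rewrite v0 => /positiveR_ge0; rewrite lecE /= eqxx.
Qed.

Lemma scalar_value_ge0 x : scalars x -> positive x -> complex_le 0 (scalar_value x).
Proof. by case=> c _ <- /scalar_positive; rewrite scalar_valueE. Qed.

Definition states : set (D -> R[i]^o) :=
  positive_extensions (le := @complex_le R) scalars scalar_value.

(** If [1/4 <= a <= 3/4] then [b |-> f (a b)] and [b |-> f ((1 - a) b)] are
    positive multiples of states with sum [f], so both are proportional to the
    extreme point [f]. *)
Lemma extreme_state_mul f : Ext states f -> forall a b, f (a * b) = f a * f b.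
Proof.
move=> [[fl fp fE] fext].
have fc (c : R[i]) : f c%:A = c by rewrite fE ?scalar_valueE //; exists c.
have f1 : f 1 = 1 by rewrite -[X in f X]scale1r fc.
have fZ (c : R[i]) x : f (c *: x) = c * f x by exact: (linear_onZ subspaceT fl).
(* the bounds make both weights [f a] and [f (1 - a)] nonzero *)
have mid a b : positive (a - (4^-1)%:C%:A) -> positive ((3 / 4)%:C%:A - a) ->
    f (a * b) = f a * f b.
  move=> pa qa.
  have := fp _ pa; have := fp _ qa; rewrite /complex_le.
  rewrite !(linear_onB subspaceT fl) // !fc !subr_ge0.
  have [t [t' faE]] : exists t t', f a = t +i* t' by case: (f a) => u v; exists u, v.
  rewrite {1 2}faE !lecE /= => /andP[/eqP t'0 t3] /andP[_ t1].
  have t01 : 0 < t < 1 by apply/andP; split; lra.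
  have tp : 0 < t by case/andP: t01.
  have tp' : 0 < 1 - t by rewrite subr_gt0; case/andP: t01.
  have ap : positive a.
    rewrite -(subrK (4^-1)%:C%:A a); apply: positiveD => //.
    by apply: positiveR; lra.
  have ap' : positive (1 - a).
    rewrite -(subrKA (3 / 4)%:C%:A); apply: positiveD => //.
    have -> : 1 - (3 / 4)%:C%:A = (1 - 3 / 4)%:C%:A :> D.
      by rewrite rmorphB scalerBl scale1r.
    by apply: positiveR; lra.
  pose y x : R[i]^o := (t^-1)%:C * f (a * x).
  pose z x : R[i]^o := ((1 - t)^-1)%:C * f ((1 - a) * x).
  have weight_state (s : R) (c : D) : 0 < s -> positive c -> f c = s%:C ->
      states (fun x => (s^-1)%:C * f (c * x)).
    move=> s0 cp fcs; split=> [k u v _ _|x xp|_ [k _ <-]].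
    - rewrite mulrDr -scalerAr (linear_onD fl) // fZ mulrDr; congr (_ + _).
      by rewrite mulrCA.
    - apply: mulr_ge0; last exact: (fp _ (positiveM cp xp (DC _ _))).
      by rewrite ler0c invr_ge0 ltW.
    - rewrite scalar_valueE -scalerAr mulr1 fZ fcs mulrCA -rmorphM.
      by rewrite mulVf ?gt_eqF // mulr1.
  have fa : f a = t%:C by rewrite faE -t'0.
  have fa' : f (1 - a) = (1 - t)%:C.
    by rewrite (linear_onB subspaceT fl) // f1 fa rmorphB.
  have [||||yf _] := fext y z t.
  - exact: weight_state.
  - exact: weight_state.
  - exact: t01.
  - apply/funext => x; rewrite /y /z.
    rewrite -[RHS]/(t%:C * ((t^-1)%:C * f (a * x)) +
       (1 - t)%:C * (((1 - t)^-1)%:C * f ((1 - a) * x))).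
    rewrite !mulrA -!rmorphM !mulfV ?gt_eqF // !mul1r -(linear_onD fl) //.
    by rewrite -mulrDl addrC subrK mul1r.
  have yb : y b = f b by rewrite yf.
  by rewrite fa -yb /y mulrA -rmorphM mulfV ?gt_eqF // mul1r.
(* self-adjoint elements are moved into that range by an affine map *)
have sa a b : selfadjoint a -> f (a * b) = f a * f b.
  move=> as_; pose s := (4 * (cnorm a + 1))^-1.
  have n0 := cnorm_ge0 a.
  have sp : 0 < s by rewrite invr_gt0 mulr_gt0 // ltr_wpDl.
  have s4 : s * cnorm a <= 4^-1.
    by rewrite /s mulrC ler_pdivrMr; lra.
  have bound c : selfadjoint c -> cnorm c <= 4^-1 -> positive ((4^-1)%:C%:A - c : D).
    move=> cs c4; rewrite -(subrKA (cnorm c)%:C%:A).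
    apply: positiveD; last exact: positive_norm.
    by rewrite -scalerBl -rmorphB; apply: positiveR; rewrite subr_ge0.
  have san : cnorm (s%:C *: a) <= 4^-1 by rewrite cnormZR // ltW.
  have := @mid ((2^-1)%:C%:A + s%:C *: a) b.
  have -> : (2^-1)%:C%:A + s%:C *: a - (4^-1)%:C%:A = (4^-1)%:C%:A - (- (s%:C *: a)).
    rewrite opprK addrAC -scalerBl -rmorphB; congr (_%:C%:A + _); lra.
  have -> : (3 / 4)%:C%:A - ((2^-1)%:C%:A + s%:C *: a) = (4^-1)%:C%:A - s%:C *: a.
    rewrite opprD addrA -scalerBl -rmorphB; congr (_%:C%:A - _); lra.
  move=> /(_ (bound _ (saN (saZ _ as_)) _)); rewrite cnormN => /(_ san).
  move=> /(_ (bound _ (saZ _ as_) san)).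
  rewrite mulrDl !(linear_onD fl) // -!scalerAl mul1r !fZ f1 mulr1 mulrDl.
  move=> /addrI; rewrite -mulrA; apply: mulfI.
  by rewrite (fmorph_eq0 (real_complex R)) gt_eqF.
move=> a b.
pose F x : R[i]^o := f (x * b); pose G x : R[i]^o := f x * f b.
apply: (@linear_on_eq_sa _ _ _ (operator_systemT D) _ F G) => // [k x y _ _|k x y _ _|x _].
- by rewrite /F mulrDl -scalerAl fl.
- by rewrite /G fl // mulrDl; congr (_ + _); rewrite -[LHS]mulrA.
- exact: sa.
Qed.

Definition character := {chi : D -> R[i]^o |
  [/\ linear_on [set: D] chi, chi 1 = 1, forall a b, chi (a * b) = chi a * chi b &
      forall a, chi (star a) = conjc (chi a)]}.

(** The largest value of a state at a positive element is its norm, and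
    [positive_extension] attains it at an extreme state. *)
Lemma character_norming a : positive a -> exists chi : character,
  sval chi a = (cnorm a)%:C.
Proof.
move=> ap; have as_ := positive_sa ap.
have [p [p_le p_ge _ p_ext]] := positive_extension (@complex_order_complete R)
  scalars_operator_system scalar_value_linear scalar_value_ge0.
have paE : p a = (cnorm a)%:C.
  apply: (ole_anti (@complex_order_complete R)).
    rewrite -[(cnorm a)%:C]scalar_valueE; apply: p_le => //.
      by exists (cnorm a)%:C.
    exact: positive_norm.
  apply: p_ge => // _ [c _ <-] ca; rewrite scalar_valueE.
  have c0 : 0 <= c.
    by apply: scalar_positive; rewrite -(subrK a c%:A); exact: positiveD.
  have [cE c0'] := complex_ge0P c0.
  have := cnorm_le_positive ap ca; rewrite cE cnormR //.
  by rewrite /complex_le lecR.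
have [f fe fa] := p_ext a as_.
have [[fl fp fE] _] := fe.
have f1 : f 1 = 1 by rewrite -[X in f X]scale1r fE ?scalar_valueE //; exists 1.
unshelve eexists.
  exists f; split=> //; first exact: extreme_state_mul.
  exact: state_star.
by rewrite /= fa.
Qed.

Lemma character_sq (chi : character) a :
  (Normc.normc (sval chi a) ^+ 2)%:C = sval chi (star a * a).
Proof.
by case: chi => f [fl f1 fM fs] /=; rewrite fM fs conjc_mul_normc.
Qed.

Lemma character_ge0 (chi : character) a : positive a -> 0 <= sval chi a.
Proof. by case=> y ->; rewrite -character_sq ler0c sqr_ge0. Qed.

Lemma character_le (chi : character) a : Normc.normc (sval chi a) <= cnorm a.
Proof.
rewrite -ler_sqr ?nnegrE ?normc_ge0 ?cnorm_ge0 // -cnorm_star_mul -lecR.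
rewrite character_sq.
have p := character_ge0 chi (positive_norm (positive_sa (positive_gram a))).
have [fl f1 _ _] := svalP chi.
rewrite (linear_onB subspaceT fl) // (linear_onZ subspaceT fl) // f1 subr_ge0 in p.
by apply: le_trans p _; rewrite -[leLHS]/(_ * 1) mulr1.
Qed.

End Characters.

(** * The injective envelope of a commutative algebra *)

Section Gelfand.
Context {R : realType} {D : cstarAlgType R}.
Hypothesis DC : forall x y : D, x * y = y * x.

Lemma gelfand_subproof (d : D) :
  exists M : R, forall chi : character, Normc.normc (sval chi d) <= M.
Proof. by exists (cnorm d) => chi; exact: character_le. Qed.

Variable x0 : @character R D.
Local Notation L := (bounded_fun (R := R) x0).

Definition gelfand (d : D) : L :=
  exist _ (fun chi => sval chi d) (gelfand_subproof d).

Lemma gelfand_linear : linear_on [set: D] gelfand.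
Proof.
move=> a x y _ _; apply: bounded_fun_ext => -[chi [cl c1 cM cs]] /=.
by rewrite cl.
Qed.

Lemma gelfand1 : gelfand 1 = 1.
Proof. by apply: bounded_fun_ext => -[chi [cl c1 cM cs]]. Qed.

Lemma gelfandM x y : gelfand (x * y) = gelfand x * gelfand y.
Proof. by apply: bounded_fun_ext => -[chi [cl c1 cM cs]] /=; rewrite cM. Qed.

Lemma gelfand_star x : gelfand (star x) = star (gelfand x).
Proof. by apply: bounded_fun_ext => -[chi [cl c1 cM cs]] /=; rewrite cs. Qed.

Lemma gelfand_norm d : cnorm (gelfand d) = cnorm d.
Proof.
apply: le_anti; apply/andP; split; first by apply: bf_norm_le => chi; exact: character_le.
have [chi chiE] := character_norming DC (positive_gram d).
apply: le_trans (bf_norm_ge (gelfand d) chi).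
rewrite -ler_sqr ?nnegrE ?cnorm_ge0 ?normc_ge0 // -cnorm_star_mul -lecR -chiE.
by rewrite character_sq.
Qed.

Lemma gelfand_sum (I : Type) (r : seq I) (F : I -> D) :
  gelfand (\sum_(i <- r) F i) = \sum_(i <- r) gelfand (F i).
Proof.
apply: big_morph; first by move=> a b; rewrite (linear_onD gelfand_linear).
exact: (linear_on0 subspaceT gelfand_linear).
Qed.

Lemma gelfand_mulmx m n p (X : 'M[D]_(m, n)) (Y : 'M[D]_(n, p)) :
  map_mx gelfand (X *m Y) = map_mx gelfand X *m map_mx gelfand Y.
Proof.
apply/matrixP => i k; rewrite !mxE gelfand_sum; apply: eq_bigr => l _.
by rewrite gelfandM !mxE.
Qed.

Lemma gelfand_cvnorm n (v : 'cV[D]_n) : cvnorm (map_mx gelfand v) = cvnorm v.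
Proof.
rewrite !cvnormE -[in RHS]gelfand_norm !ipE gelfand_sum; congr (Num.sqrt (cnorm _)).
by apply: eq_bigr => i _; rewrite gelfandM gelfand_star !mxE.
Qed.

(** The norm of a matrix of bounded functions is the supremum of the norms of
    its values at the characters, and those are norms of the matrix over [D]
    restricted to columns of scalars. *)
Lemma gelfand_complete_isometry :
  unital_complete_isometry [set: D] [set: L] gelfand.
Proof.
split; first by split=> //; [exact: gelfand1 | exact: gelfand_linear].
move=> n X _; apply: le_anti; apply/andP; split; last first.
  apply: mxnorm_le => v v1; rewrite -gelfand_cvnorm gelfand_mulmx.
  by apply: mxnorm_ge1; rewrite gelfand_cvnorm.
apply: mxnorm_le => w w1.
rewrite -ler_sqr ?nnegrE ?cvnorm_ge0 ?mxnorm_ge0 // cvnorm_sq.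
apply: bf_norm_le => chi; have [cl c1 cM cs] := svalP chi.
pose c : 'cV[D]_n := \col_i (sval (w i 0) chi)%:A.
have cZ (k : R[i]) x : sval chi (k *: x) = k * sval chi x.
  exact: (linear_onZ subspaceT cl).
have csum (I : Type) (r : seq I) (F : I -> D) :
    sval chi (\sum_(i <- r) F i) = \sum_(i <- r) sval chi (F i).
  apply: big_morph; first by move=> a b; rewrite (linear_onD cl).
  exact: (linear_on0 subspaceT cl).
have cn : cvnorm c <= 1.
  have e : ip c c = (sval (ip w w) chi)%:A.
    rewrite !ipE bf_sumE scaler_suml; apply: eq_bigr => i _.
    by rewrite !mxE starZ star1 -scalerAl mul1r scalerA.
  rewrite -[leRHS]ger0_norm // -ler_sqr ?nnegrE ?cvnorm_ge0 // normr1 expr1n.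
  rewrite cvnorm_sq e cnormZ cnorm1 mulr1; apply: (le_trans (bf_norm_ge _ _)).
  by rewrite -[bf_norm _]/(cnorm _) -cvnorm_sq expr_le1 ?cvnorm_ge0.
have E i : sval ((map_mx gelfand X *m w) i 0) chi = sval chi ((X *m c) i 0).
  rewrite !mxE csum bf_sumE; apply: eq_bigr => k _.
  by rewrite !mxE -scalerAr mulr1 cZ mulrC.
have -> : sval (ip (map_mx gelfand X *m w) (map_mx gelfand X *m w)) chi =
    sval chi (ip (X *m c) (X *m c)).
  rewrite !ipE bf_sumE csum; apply: eq_bigr => i _.
  by rewrite cM cs -!E.
apply: (le_trans (character_le _ _)); rewrite -cvnorm_sq.
rewrite ler_sqr ?nnegrE ?cvnorm_ge0 ?mxnorm_ge0 //.
exact: mxnorm_ge1.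
Qed.

End Gelfand.

(** The Gelfand map extends to a unital complete isometry of the envelope, whose
    inverse extends to all bounded functions because the envelope is injective. *)
Lemma injective_envelope_retract (R : realType) (D E : cstarAlgType R)
    (iota : {lrmorphism D -> E}) :
  (forall x y : D, x * y = y * x) -> injective_envelope iota ->
  exists (x0 : @character R D) (tau : E -> bounded_fun x0) (rho : bounded_fun x0 -> E),
    [/\ ucp [set: E] [set: bounded_fun x0] tau,
        ucp [set: bounded_fun x0] [set: E] rho & cancel tau rho].
Proof.
move=> DC [_ Einj Emin].
have [x0 _] := character_norming DC positive0.
have [tau ti _] := Emin _ _ (@operator_systemT R (bounded_fun x0))
  (@bounded_fun_injective R _ x0) _ (gelfand_complete_isometry DC x0).
have [sE [g [gu gK]]] := unital_complete_isometry_inverse ti.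
have [rho ru rhoE] := Einj _ _ _ sE (@operator_systemT R _) (@subsetT _ _) _ gu.
exists x0, tau, rho; split=> //.
  exact: (unital_complete_isometry_ucp subspaceT I ti).
by move=> x; rewrite rhoE ?gK //; exists x.
Qed.

(** A negative part of [d] would survive in the larger algebra. *)
Lemma star_embedding_positive (R : realType) (A B : cstarAlgType R)
    (f : {lrmorphism A -> B}) d : star_embedding f -> positive (f d) -> positive d.
Proof.
move=> [fs f_inj] fp; have ds : selfadjoint d.
  by rewrite /selfadjoint /=; apply: f_inj; rewrite fs; exact: (positive_sa fp).
have [b [c [bs cs bdb c0]]] := negative_part ds; apply/positiveP/c0.
apply: f_inj; rewrite rmorph0.
have fbs : star (f b) = f b by rewrite -fs bs.
have fcs : selfadjoint (f c) by rewrite /selfadjoint /= -fs cs.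
apply: sa_sq_eq0 => //; apply: positive_anti; first exact/positiveP/pcone_sq.
have := positive_conj (f b) fp; rewrite fbs -!rmorphM bdb rmorphN.
by rewrite rmorphM.
Qed.

Lemma star_morphism_positive (R : realType) (A B : cstarAlgType R)
    (f : {lrmorphism A -> B}) d : (forall x, f (star x) = star (f x)) ->
  positive d -> positive (f d).
Proof. by move=> fs [y ->]; exists (f y); rewrite -fs -rmorphM. Qed.

(** * Pseudo-expectations *)

Section PseudoExpectations.
Context {R : realType} {C D E : cstarAlgType R}.
Variables (j : {lrmorphism D -> C}) (iota : {lrmorphism D -> E}).
Hypotheses (hj : star_embedding j) (hi : star_embedding iota).

(** The map [j d |-> iota d] on the copy of [D] in [C]. *)
Definition transported (x : C) : E :=
  if pselect (exists d, j d = x) is left h then iota (projT1 (cid h)) else 0.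

Lemma transportedE d : transported (j d) = iota d.
Proof.
rewrite /transported; case: pselect => [h|[]]; last by exists d.
by congr (iota _); apply: hj.2; exact: (projT2 (cid h)).
Qed.

Lemma range_operator_system : operator_system (range j).
Proof.
split; first by exists 1; rewrite ?rmorph1.
  by move=> a _ _ [x _ <-] [y _ <-]; exists (a *: x + y); rewrite // linearP.
by move=> _ [x _ <-]; exists (star x); rewrite // hj.1.
Qed.

Lemma transported_linear : linear_on (range j) transported.
Proof.
by move=> a _ _ [x _ <-] [y _ <-]; rewrite -linearP !transportedE linearP.
Qed.

Lemma transported_ge0 x : range j x -> positive x -> cle 0 (transported x).
Proof.
move=> [d _ <-] /(star_embedding_positive hj) dp.
by rewrite /cle subr0 transportedE; exact: (star_morphism_positive hi.1).
Qed.

(** Complete positivity is automatic: a positive map into a retract of an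
    algebra of bounded functions factors through a positive map into that
    algebra. *)
Lemma PsExpE (X : Type) (x0 : X) (tau : E -> bounded_fun (R := R) x0)
    (rho : bounded_fun x0 -> E) :
  ucp [set: E] [set: bounded_fun x0] tau -> ucp [set: bounded_fun x0] [set: E] rho ->
  cancel tau rho ->
  PsExp j iota = positive_extensions (le := @cle R E) (range j) transported.
Proof.
move=> tu ru tauK; apply/seteqP; split=> Phi.
  move=> [Pu Pj]; split; first exact: (ucp_linear Pu).
    by move=> x xp; rewrite /cle subr0; exact: (ucp_positive Pu).
  by move=> _ [d _ <-]; rewrite transportedE.
move=> [Pl Pp PE]; split; last by move=> d; rewrite PE ?transportedE //; exists d.
have P1 : Phi 1 = 1.
  by rewrite -(rmorph1 j) PE; [rewrite transportedE rmorph1 | exists 1].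
have -> : Phi = rho \o (tau \o Phi) by apply/funext => x /=; rewrite tauK.
apply: ucp_comp ru; have [[tau1 _ tl] _] := tu.
apply: positive_bf_ucp => [a x y _ _||b bp] /=; rewrite ?P1 ?Pl ?tl //.
apply: (ucp_positive tu) => //.
by have := Pp b bp; rewrite /cle subr0.
Qed.

End PseudoExpectations.

Theorem theorem3p18 (R : realType) (C D ID : cstarAlgType R)
    (j : {lrmorphism D -> C}) (hj : star_embedding j)
    (hD : forall x y : D, x * y = y * x)
    (iota : {lrmorphism D -> ID}) (hI : injective_envelope iota) :
  [/\ Ext (PsExp j iota) !=set0,
      exists P : C -> ID,
        (forall x, selfadjoint x ->
           is_sup_sa [set Psi x | Psi in Ext (PsExp j iota)] (P x)) /\
        PsExp j iota =
          [set Phi | UCP Phi /\ forall x, selfadjoint x -> cle (Phi x) (P x)]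
    & (exists! Phi : C -> ID, PsExp j iota Phi) <->
      (exists! Psi : C -> ID, Ext (PsExp j iota) Psi)].
Proof.
have [hi _ _] := hI.
have [x0 [tau [rho [tu ru tauK]]]] := injective_envelope_retract hD hI.
have leID := bounded_retract_complete tu ru tauK.
have PsE := PsExpE iota hj tu ru tauK.
have [p [p_le p_ge p_pe p_ext]] := positive_extension leID
  (range_operator_system hj) (transported_linear iota hj) (transported_ge0 hj hi).
rewrite -PsE in p_pe p_ext.
have p_dom Phi x : PsExp j iota Phi -> selfadjoint x -> cle (Phi x) (p x).
  rewrite PsE => -[Pl Pp PE] xs; apply: p_ge => // e Ee ex; rewrite -PE //.
  by have := Pp _ ex; rewrite /cle subr0 (linear_onB subspaceT Pl).
have Ext_PsExp Psi : Ext (PsExp j iota) Psi -> PsExp j iota Psi by case.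
have [Psi0 Psi0E _] := p_ext 0 sa0.
split.
- by exists Psi0.
- exists p; split=> [x xs|].
    have [Psi PsiE PsixE] := p_ext x xs; split.
    + have [[Pu _] _] := PsiE.
      by rewrite -PsixE; exact: (ucp_sa (operator_systemT C) Pu).
    + by move=> _ [Phi /Ext_PsExp PhiE <-]; exact: p_dom.
    + by move=> u us; apply; exists Psi.
  apply/seteqP; split=> Phi [Pu H]; first by split=> // x; exact: p_dom.
  by apply: p_pe => //; exact: (ucp_linear Pu).
split=> [[Phi [PhiP Phi_uniq]]|[Psi [PsiE Psi_uniq]]].
- exists Psi0; split=> // Psi /Ext_PsExp Psi_P.
  by rewrite -(Phi_uniq _ (Ext_PsExp _ Psi0E)) -(Phi_uniq _ Psi_P).
exists Psi; split=> [|Phi PhiP]; first exact: Ext_PsExp.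
have PhiPsi x : selfadjoint x -> cle (Phi x) (Psi x).
  move=> xs; have [Psi' /Psi_uniq <- ->] := p_ext x xs; exact: p_dom.
have Pl := ucp_linear PhiP.1; have Psl := ucp_linear (Ext_PsExp _ PsiE).1.
apply/funext => x; apply: (linear_on_eq_sa (operator_systemT C)) => // y _ ys.
apply: (ole_anti leID); last exact: PhiPsi.
have := PhiPsi _ (saN ys).
by rewrite (linear_onN subspaceT Pl) // (linear_onN subspaceT Psl) // /cle opprK addrC.
Qed.
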